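(* Suppose that $$ n\min\{q,1-q\}\ge n^{-o(1)},\qquad \rho^2>\alpha,\qquad \omega(1)\le K\le \frac{\log n}{\max\left\{16\log\log n,\ 2\log\left(\frac{1}{n\min\{q,1-q\}}\right)\right\}},$$ where $\alpha\approx 0.33833$ is Otter's constant. Then the testing error satisfies, as $n\to\infty$, $$\mathcal Q\left(f_{\mathcal T}(A,B)\ge\tau\right)+\mathcal P\left(f_{\mathcal T}(A,B)\le\tau\right)=o(1),$$ where the threshold is chosen as $$\tau = C\,\mathbb{E}_{\mathcal P}[f_{\mathcal T}(A,B)] = C\rho^{2K}|\mathcal T|$$ for any fixed constant $0<C<1$.
   Context: Model. $[n]=\{1,\dots,n\}$. Let $q\in(0,1)$ and $\rho\in[-\min\{\frac{q}{1-q},\frac{1-q}{q}\},1]$. $A=(A_{ij})$ and $B=(B_{ij})$ are the adjacency matrices of two random simple graphs $G_1,G_2$ on vertex set $[n]$. Under $\mathcal Q$ (null hypothesis), $G_1,G_2$ are independent Erdős–Rényi graphs $\mathcal G(n,q)$. Under $\mathcal P$ (alternative hypothesis), $\pi$ is a uniformly random permutation of $[n]$ and, conditionally on $\pi$, the pairs $(A_{ij},B_{\pi(i)\pi(j)})$, $1\le i<j\le n$, are i.i.d. pairs of Bernoulli($q$) random variables with correlation coefficient $\rho$. $\mathbb E_{\mathcal P},\mathbb E_{\mathcal Q}$ denote the corresponding expectations. Put $\bar A=A-\mathbb E A$, $\bar B=B-\mathbb E B$ (so off-diagonal entries are $A_{ij}-q$, $B_{ij}-q$). Test statistic. $K$ is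 a positive integer. $\mathcal T$ is the set of unlabeled trees (isomorphism classes $[H]$ of trees) with $K$ edges, and $\mathrm{aut}(H)$ is the number of automorphisms of $H$. For a symmetric matrix $M$ indexed by $[n]$, $$W_H(M)=\sum_{S\cong H}\prod_{(i,j)\in S}M_{ij},$$ where the sum is over subgraphs $S$ of the complete graph on $[n]$ isomorphic to $H$ (the product being over edges of $S$). With $\beta=\left(\frac{\rho}{q(1-q)}\right)^K\frac{(n-K-1)!}{n!}$, $$f_{\mathcal T}(A,B)=\sum_{[H]\in\mathcal T}\beta\,\mathrm{aut}(H)\,W_H(\bar A)\,W_H(\bar B).$$ Otter's constant $\alpha\approx0.33833$ is defined by $\lim_{K\to\infty}|\mathcal T|^{1/K}=1/\alpha$. Asymptotic notation is as $n\to\infty$: the condition $n\min\{q,1-q\}\ge n^{-o(1)}$ means that there is a sequence $\varepsilon_n\to0$ with $n\min\{q,1-q\}\ge n^{-\varepsilon_n}$, and $\omega(1)\le K$ means $K\to\infty$. *)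

(* Defs.v *)
From HB Require Import structures.
From mathcomp Require Import all_boot all_order all_algebra all_fingroup.
From mathcomp Require Import all_classical all_reals all_analysis.
From mathcomp Require Import ring.
Set Implicit Arguments.
Unset Strict Implicit.
Unset Printing Implicit Defensive.
Import Order.TTheory GRing.Theory Num.Theory.
Import numFieldNormedType.Exports.
Local Open Scope classical_set_scope.
Local Open Scope ring_scope.

Definition is_adjacency n (M : 'M[bool]_n) : bool :=
  [forall i, ~~ M i i] && [forall i, forall j, M i j == M j i].

(* Vertices are numbered from 0; [G i j] holds when {i, j} is an edge. *)
Record sgraph n := SGraph {
  adjacency :> 'M[bool]_n;
  adjacencyP : is_adjacency adjacency }.
HB.instance Definition _ n := [isSub for @adjacency n].
HB.instance Definition _ n := [Finite of sgraph n by <:].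

Definition edges n (G : sgraph n) : {set 'I_n * 'I_n} :=
  [set e : 'I_n * 'I_n | (e.1 < e.2)%N && G e.1 e.2]%SET.

Definition connected_graph m (H : sgraph m) : Prop :=
  forall x y : 'I_m, connect (fun i j => H i j) x y.

(* Sequences of length 2 are excluded because going back and forth along an
   edge satisfies [ucycle]. *)
Definition acyclic_graph m (H : sgraph m) : Prop :=
  forall c : seq 'I_m, (2 < size c)%N -> ~ ucycle (fun i j => H i j) c.

Definition is_tree m (H : sgraph m) : Prop :=
  connected_graph H /\ acyclic_graph H.

Definition graph_iso m (H H' : sgraph m) : bool :=
  [exists s : 'S_m, [forall i, forall j, H' (s i) (s j) == H i j]].

Definition aut m (H : sgraph m) : nat :=
  #|[set s : 'S_m | [forall i, forall j, H (s i) (s j) == H i j]]%SET|.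

(* A tree with K edges has K + 1 vertices, so up to isomorphism it lives
   on 'I_K.+1. *)
Definition trees K : {set sgraph K.+1} :=
  [set H : sgraph K.+1 | `[< is_tree H >] && (#|edges H| == K)]%SET.

Definition unlabeled_trees K : {set {set sgraph K.+1}} :=
  equivalence_partition (@graph_iso K.+1) (trees K).

(* One tree in each isomorphism class. *)
Definition tree_reprs K : {set sgraph K.+1} :=
  transversal (unlabeled_trees K) (trees K).

(* A subgraph of the complete graph on 'I_n is a pair (vertex set, edges). *)
Definition is_subgraph n (S : {set 'I_n} * sgraph n) : bool :=
  [forall i, forall j, S.2 i j ==> (i \in S.1) && (j \in S.1)].

Definition is_copy m n (H : sgraph m) (S : {set 'I_n} * sgraph n) : bool :=
  is_subgraph S &&
  [exists f : {ffun 'I_m -> 'I_n},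
    [&& injectiveb f, [set f x | x in 'I_m]%SET == S.1
      & [forall x, forall y, S.2 (f x) (f y) == H x y]]].

Section Statistic.
Variable R : realType.

Definition W m n (H : sgraph m) (M : 'M[R]_n) : R :=
  \sum_(S : {set 'I_n} * sgraph n | is_copy H S)
    \prod_(e in edges S.2) M e.1 e.2.

Definition centered n (q : R) (G : sgraph n) : 'M[R]_n :=
  \matrix_(i, j) (if i == j then 0 else (G i j)%:R - q).

(* The subtraction on nat is meaningful for K < n only. *)
Definition beta n K (q rho : R) : R :=
  (rho / (q * (1 - q))) ^+ K * ((n - K - 1)`!%:R / n`!%:R).

Definition f_stat n K (q rho : R) (AB : sgraph n * sgraph n) : R :=
  \sum_(H in tree_reprs K)
    beta n K q rho * (aut H)%:R
      * W H (centered q AB.1) * W H (centered q AB.2).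

Definition bern (q : R) (a : bool) : R := if a then q else 1 - q.

(* Joint mass function of two Bernoulli(q) variables with correlation
   coefficient rho; see the lemmas below. *)
Definition corr_bern (q rho : R) (a b : bool) : R :=
  bern q a * bern q b + (if a == b then 1 else -1) * (rho * (q * (1 - q))).

Lemma corr_bern_marginall q rho a :
  \sum_(b : bool) corr_bern q rho a b = bern q a.
Proof. by rewrite big_bool /corr_bern /bern; case: a => /=; ring. Qed.

Lemma corr_bern_marginalr q rho b :
  \sum_(a : bool) corr_bern q rho a b = bern q b.
Proof. by rewrite big_bool /corr_bern /bern; case: b => /=; ring. Qed.

Lemma corr_bern_covariance q rho :
  \sum_(a : bool) \sum_(b : bool)
    corr_bern q rho a b * ((a%:R - q) * (b%:R - q)) = rho * (q * (1 - q)).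
Proof. by rewrite !big_bool /corr_bern /bern /=; ring. Qed.

Definition null_pmf n (q : R) (AB : sgraph n * sgraph n) : R :=
  (\prod_(e : 'I_n * 'I_n | (e.1 < e.2)%N) bern q (AB.1 e.1 e.2)) *
  (\prod_(e : 'I_n * 'I_n | (e.1 < e.2)%N) bern q (AB.2 e.1 e.2)).

(* Law of (A, B) alone: the uniform latent permutation is averaged out. *)
Definition alt_pmf n (q rho : R) (AB : sgraph n * sgraph n) : R :=
  \sum_(s : 'S_n) n`!%:R^-1 *
    \prod_(e : 'I_n * 'I_n | (e.1 < e.2)%N)
      corr_bern q rho (AB.1 e.1 e.2) (AB.2 (s e.1) (s e.2)).

Definition pr (T : finType) (p : T -> R) (E : pred T) : R :=
  \sum_(x | E x) p x.

Definition mean (T : finType) (p : T -> R) (X : T -> R) : R :=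
  \sum_x p x * X x.

Definition is_otter_constant (alpha : R) : Prop :=
  (#|unlabeled_trees K|%:R `^ (K%:R^-1)) @[K --> \oo] --> alpha^-1.

End Statistic.

(* Main.v *)
(* Relabeling the vertices of B does not change f_T, so under P the latent
   permutation may be taken to be the identity; Q is the case rho = 0 of the
   same coupled law. Writing aut(H) W_H as a sum over embeddings of H, the
   second moment of f_T becomes a sum over quadruples of embedded trees
   (S1, T1 in A, S2, T2 in B) of products of edge moments, and a quadruple
   contributes only when every edge of the union is covered at least twice.
   If the union is connected, it has at most one more vertex than edges, which
   costs a factor 1/n against the normalisation and leaves, after counting,
   at most n^(-1/8) for K <= log n / max(...). If it is disconnected, then
   either {S1, S2} and {T1, T2} are disjoint, and the covariance vanishes, or
   S1 = T1 and S2 = T2, or S1 = T2 and S2 = T1; the last two cases contribute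
   1/(rho^(2K) |T|) each, which tends to 0 since rho^2 > alpha. Chebyshev's
   inequality concludes. *)
Require Import Defs.
From mathcomp Require Import all_boot all_order all_algebra all_fingroup.
From mathcomp Require Import all_classical all_reals all_analysis.
From mathcomp Require Import zify ring lra.
Set Implicit Arguments.
Unset Strict Implicit.
Unset Printing Implicit Defensive.
Import Order.TTheory GRing.Theory Num.Theory.
Import numFieldNormedType.Exports.
Local Open Scope set_scope.
Local Open Scope ring_scope.

(** * Embeddings and copies of a graph *)

(** The exponents behind the connected case are as follows. With [s = q(1-q)], unions on [v]
    vertices weigh at most [n^v s^(v-1)], up to the number of ways to place four trees on [v] given
    vertices, against [n^(2K+2) s^(2K)] in the squared normalisation. Double covering leaves at most
    2K of the 4K edge incidences as distinct edges, so [v - 1 <= 2K], and the ratio is [1/n] times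
    [(1/(ns))^(2K-v+1)]. This last exponent is at most K; in sparse graphs the factor is large, and
    the second entry of the maximum bounding K caps it at [n^(1/2)], up to [2^K]. The first entry
    pays for everything else (placements, [rho^(-2K)], constants) with [n^(6/16)], and 1 - 1/2 -
    6/16 = 1/8. The number of tree classes cancels between this bound and the squared mean, so
    Otter's constant acts through the growth of the mean. Connected components of the union are
    never formed. A maximal subfamily of the four trees with at most one more vertex than edges
    replaces them: the trees left out avoid its vertices. *)

Lemma sgraph_sym n (G : sgraph n) i j : G i j = G j i.
Proof.
by have /andP[_ /forallP/(_ i)/forallP/(_ j)/eqP] := adjacencyP G.
Qed.

Lemma sgraph_irr n (G : sgraph n) i : G i i = false.
Proof. by have /andP[/forallP/(_ i)/negbTE] := adjacencyP G. Qed.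

Lemma mem_edges n (G : sgraph n) e :
  (e \in edges G) = (e.1 < e.2)%N && G e.1 e.2.
Proof. by rewrite inE. Qed.

Lemma sgraph_eqP n (G G' : sgraph n) : (forall i j, G i j = G' i j) -> G = G'.
Proof. by move=> eqG; apply/val_inj/matrixP. Qed.

Lemma edges_inj n : injective (@edges n).
Proof.
move=> G G' eqE; apply: sgraph_eqP => i j.
have lt_eq (x y : 'I_n) : (x < y)%N -> G x y = G' x y.
  move=> xy; have := congr1 (fun A : {set _} => (x, y) \in A) eqE.
  by rewrite !mem_edges /= xy.
case: (ltngtP i j) => [|ji|/val_inj ->]; first exact: lt_eq.
  by rewrite sgraph_sym lt_eq // sgraph_sym.
by rewrite !sgraph_irr.
Qed.

(** Edges are stored with the smaller endpoint first and an embedding need not be monotone, so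
    images of edges are sorted again. *)
Definition sorted_pair n (i j : 'I_n) := if (i < j)%N then (i, j) else (j, i).

Definition image_edges m n (H : sgraph m) (f : {ffun 'I_m -> 'I_n}) :
    {set 'I_n * 'I_n} :=
  [set sorted_pair (f e.1) (f e.2) | e in edges H].

(** The conjunct [i != j] gives a simple graph even when [f] is not injective, so [image_graph]
    needs no side condition. *)
Lemma image_adjacency m n (H : sgraph m) (f : {ffun 'I_m -> 'I_n}) :
  is_adjacency (\matrix_(i, j) ((i != j) &&
    [exists x, exists y, [&& f x == i, f y == j & H x y]])).
Proof.
apply/andP; split; first by apply/forallP => i; rewrite mxE eqxx.
apply/forallP => i; apply/forallP => j; rewrite !mxE (eq_sym i).
apply/eqP.
congr andb; apply/existsP/existsP => -[x /existsP[y /and3P[fx fy Hxy]]];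
  by exists y; apply/existsP; exists x; rewrite fx fy sgraph_sym.
Qed.

Definition image_graph m n (H : sgraph m) (f : {ffun 'I_m -> 'I_n}) : sgraph n :=
  SGraph (image_adjacency H f).

Lemma image_graphP m n (H : sgraph m) (f : {ffun 'I_m -> 'I_n}) i j :
  injective f ->
  reflect (exists x y, [/\ f x = i, f y = j & H x y]) (image_graph H f i j).
Proof.
move=> f_inj; rewrite mxE; apply: (iffP andP).
  by move=> [_ /existsP[x /existsP[y /and3P[/eqP fx /eqP fy Hxy]]]]; exists x, y.
move=> [x [y [fx fy Hxy]]]; split; last first.
  by apply/existsP; exists x; apply/existsP; exists y; rewrite fx fy !eqxx.
by apply: contraTneq Hxy => ij; rewrite (f_inj x y) ?sgraph_irr // fx fy.
Qed.

Lemma image_graphE m n (H : sgraph m) (f : {ffun 'I_m -> 'I_n}) x y :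
  injective f -> image_graph H f (f x) (f y) = H x y.
Proof.
move=> f_inj; apply/image_graphP/idP => // [[x' [y' [/f_inj-> /f_inj->]]] //|Hxy].
by exists x, y.
Qed.

Lemma edges_image_graph m n (H : sgraph m) (f : {ffun 'I_m -> 'I_n}) :
  injective f -> edges (image_graph H f) = image_edges H f.
Proof.
move=> f_inj; apply/setP => -[i j]; rewrite mem_edges /=; apply/andP/imsetP.
  move=> [ij /image_graphP[//|x [y [fx fy Hxy]]]]; subst i j.
  case: (ltngtP x y) => [xy|yx|/val_inj xy]; last by rewrite xy sgraph_irr in Hxy.
    by exists (x, y); rewrite ?mem_edges /= ?xy // /sorted_pair ij.
  exists (y, x); first by rewrite mem_edges /= yx sgraph_sym.
  by rewrite /sorted_pair /= ltnNge ltnW.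
move=> [[x y]]; rewrite mem_edges /= /sorted_pair => /andP[xy Hxy].
case: ifP => [fxy [-> ->]|/negbT]; first by rewrite fxy image_graphE.
rewrite -leqNgt leq_eqVlt => /orP[/eqP/val_inj/f_inj yx|fyx [-> ->]].
  by rewrite yx ltnn in xy.
by rewrite fyx image_graphE // sgraph_sym.
Qed.

Lemma sorted_pair_inj m n (H : sgraph m) (f : {ffun 'I_m -> 'I_n}) :
  injective f ->
  {in edges H &, injective (fun e => sorted_pair (f e.1) (f e.2))}.
Proof.
move=> f_inj [x y] [x' y']; rewrite !mem_edges /= /sorted_pair.
move=> /andP[xy _] /andP[xy' _].
case: ifP => _; case: ifP => _ [] /f_inj e1 /f_inj e2; subst => //.
  by have := ltn_trans xy xy'; rewrite ltnn.
by have := ltn_trans xy xy'; rewrite ltnn.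
Qed.

Lemma card_image_edges m n (H : sgraph m) (f : {ffun 'I_m -> 'I_n}) :
  injective f -> #|image_edges H f| = #|edges H|.
Proof. by move=> f_inj; rewrite card_in_imset //; exact: sorted_pair_inj. Qed.

Lemma big_image_edges (R : comRingType) m n (H : sgraph m)
    (f : {ffun 'I_m -> 'I_n}) (M : 'M[R]_n) :
  injective f -> (forall i j, M i j = M j i) ->
  \prod_(e in image_edges H f) M e.1 e.2 =
  \prod_(e in edges H) M (f e.1) (f e.2).
Proof.
move=> f_inj Msym; rewrite big_imset /=; last exact: sorted_pair_inj.
by apply: eq_bigr => e _; rewrite /sorted_pair; case: ifP => //= _.
Qed.

Definition copy_of m n (H : sgraph m) (f : {ffun 'I_m -> 'I_n}) :
    {set 'I_n} * sgraph n :=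
  ([set f x | x in 'I_m], image_graph H f).

Lemma is_copyP m n (H : sgraph m) (S : {set 'I_n} * sgraph n) :
  reflect (exists2 f : {ffun 'I_m -> 'I_n}, injective f & copy_of H f = S)
          (is_copy H S).
Proof.
apply: (iffP andP) => [[/forallP subS /existsP[f]]|[f f_inj <-]].
  move=> /and3P[/injectiveP f_inj /eqP fS /forallP HS]; exists f => //.
  case: S subS fS HS => V G /= subS fS HS; rewrite /copy_of fS; congr pair.
  apply: sgraph_eqP => i j; apply/image_graphP/idP => // [[x [y [<- <- Hxy]]]|Gij].
    by have /forallP/(_ y)/eqP -> := HS x.
  have /forallP/(_ j)/implyP/(_ Gij)/andP[] := subS i.
  rewrite -fS => /imsetP[x _ ix] /imsetP[y _ jy]; exists x, y; split=> //.
  by have /forallP/(_ y)/eqP <- := HS x; rewrite -ix -jy.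
split.
  apply/forallP => i; apply/forallP => j; apply/implyP => /= /image_graphP[//|].
  by move=> x [y [<- <- _]]; rewrite !imset_f.
apply/existsP; exists f; apply/and3P; split; [exact/injectiveP|exact/eqP|].
by apply/forallP => x; apply/forallP => y; rewrite image_graphE.
Qed.

Lemma image_perm m n (f g : {ffun 'I_m -> 'I_n}) :
  injective f -> injective g -> [set f x | x in 'I_m] = [set g x | x in 'I_m] ->
  exists s : 'S_m, forall x, g x = f (s x).
Proof.
move=> f_inj g_inj eqfg.
have ex x : exists y, g x == f y.
  have : g x \in [set f x | x in 'I_m] by rewrite eqfg imset_f.
  by case/imsetP => y _ ->; exists y.
pose s x := xchoose (ex x).
have gs x : g x = f (s x) by apply/eqP/(xchooseP (ex x)).
have s_inj : injective s by move=> x y sxy; apply: g_inj; rewrite !gs sxy.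
by exists (perm s_inj) => x; rewrite permE.
Qed.

(** Two embeddings with the same copy differ by a permutation of the vertices of [H], and this
    permutation has to be an automorphism; the fibre of [f] is thus a free orbit. *)
Lemma card_copy_fiber m n (H : sgraph m) (f : {ffun 'I_m -> 'I_n}) :
  injective f ->
  #|[set g : {ffun 'I_m -> 'I_n} | injectiveb g & copy_of H g == copy_of H f]|
  = Defs.aut H.
Proof.
move=> f_inj; pose c (s : 'S_m) : {ffun 'I_m -> 'I_n} := [ffun x => f (s x)].
have c_inj : injective c.
  move=> s t /ffunP st; apply/permP => x; apply: f_inj.
  by have := st x; rewrite !ffunE.
rewrite /Defs.aut -(card_imset _ c_inj); apply: eq_card => g; rewrite !inE.
have cs_inj s : injective (c s) by move=> x y; rewrite !ffunE => /f_inj/perm_inj.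
apply/andP/imsetP => [[/injectiveP g_inj /eqP[eqV eqG]]|[s]].
  have [s gs] := image_perm f_inj g_inj (esym eqV).
  exists s; last by apply/ffunP => x; rewrite ffunE gs.
  rewrite inE; apply/forallP => x; apply/forallP => y.
  have GE : image_graph H g = image_graph H f by apply: val_inj; exact: eqG.
  by rewrite -(image_graphE H _ _ f_inj) -!gs -GE image_graphE.
rewrite inE => /forallP autS ->; split; first exact/injectiveP.
apply/eqP; congr pair.
  apply/setP => i; apply/imsetP/imsetP => -[x _ ->].
    by exists (s x) => //; rewrite ffunE.
  by exists ((s^-1)%g x); rewrite // ffunE permKV.
have HsE x y : H ((s^-1)%g x) ((s^-1)%g y) = H x y.
  have /forallP/(_ ((s^-1)%g y))/eqP := autS ((s^-1)%g x).
  by rewrite !permKV => ->.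
apply: sgraph_eqP => i j; apply/image_graphP/image_graphP => //.
  move=> [x [y [<- <- Hxy]]]; exists (s x), (s y); rewrite !ffunE; split=> //.
  by have /forallP/(_ y)/eqP -> := autS x.
move=> [x [y [<- <- Hxy]]]; exists ((s^-1)%g x), ((s^-1)%g y).
by rewrite !ffunE !permKV HsE.
Qed.

Definition embedding_sum (R : comRingType) m n (H : sgraph m) (M : 'M[R]_n) : R :=
  \sum_(f : {ffun 'I_m -> 'I_n} | injectiveb f)
    \prod_(e in edges H) M (f e.1) (f e.2).

Lemma embedding_sumE (R : realType) m n (H : sgraph m) (M : 'M[R]_n) :
  (forall i j, M i j = M j i) ->
  embedding_sum H M = (Defs.aut H)%:R * W H M.
Proof.
move=> Msym; rewrite /embedding_sum /W big_distrr /=.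
rewrite (partition_big (fun f => copy_of H f) (is_copy H)) /=; last first.
  by move=> f /injectiveP f_inj; apply/is_copyP; exists f.
apply: eq_bigr => _ /is_copyP[f f_inj <-]; rewrite /= edges_image_graph //.
rewrite big_image_edges // -(card_copy_fiber H f_inj) -sum1dep_card natr_sum.
rewrite big_distrl /=; apply: eq_bigr => g /andP[/injectiveP g_inj /eqP fg].
rewrite mul1r -!big_image_edges // -!edges_image_graph //.
by have /(congr1 snd) /= -> := fg.
Qed.

Lemma aut_gt0 m (H : sgraph m) : (0 < Defs.aut H)%N.
Proof.
apply/card_gt0P; exists 1%g; rewrite inE.
by apply/forallP => x; apply/forallP => y; rewrite !perm1.
Qed.

Lemma connected_incident m (H : sgraph m) (x : 'I_m) :
  (1 < m)%N -> connected_graph H -> exists y, H x y.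
Proof.
move=> m_gt1 Hc.
have [z zx] : exists z, z != x.
  have : (0 < #|predC1 x|)%N by rewrite cardC1 card_ord; case: m m_gt1 {x H Hc} => [|[]].
  by case/card_gt0P => z; rewrite inE; exists z.
have /connectP[[|y p] /= Hp ez] := Hc x z; first by rewrite ez eqxx in zx.
by exists y; case/andP: Hp.
Qed.

Lemma image_edges_verts m n (H : sgraph m) (f : {ffun 'I_m -> 'I_n}) e :
  e \in image_edges H f ->
  (e.1 \in [set f x | x in 'I_m]) && (e.2 \in [set f x | x in 'I_m]).
Proof.
by case/imsetP => d _ ->; rewrite /sorted_pair; case: ifP => _ /=; rewrite !imset_f.
Qed.

Lemma image_edges_lt m n (H : sgraph m) (f : {ffun 'I_m -> 'I_n}) e :
  injective f -> e \in image_edges H f -> (e.1 < e.2)%N.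
Proof. by move=> f_inj; rewrite -edges_image_graph // mem_edges => /andP[]. Qed.

(** In a connected graph with at least two vertices every vertex lies on an edge, so the edges of a
    copy determine its vertices. This allows copies to be compared through their edge sets alone. *)
Lemma connected_image_sub m n (H I : sgraph m) (f g : {ffun 'I_m -> 'I_n}) :
  (1 < m)%N -> connected_graph H -> injective f -> injective g ->
  image_edges H f = image_edges I g ->
  [set f x | x in 'I_m] \subset [set g x | x in 'I_m].
Proof.
move=> m_gt1 Hc f_inj g_inj eqE; apply/fintype.subsetP => _ /imsetP[x _ ->].
have [y Hxy] := connected_incident x m_gt1 Hc.
have : image_graph H f (f x) (f y) by rewrite image_graphE.
rewrite -!edges_image_graph // in eqE; rewrite (edges_inj eqE).
by case/image_graphP => // x' [y' [<- _ _]]; rewrite imset_f.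
Qed.

Lemma copy_of_image_edges m n (H I : sgraph m) (f g : {ffun 'I_m -> 'I_n}) :
  (1 < m)%N -> connected_graph H -> connected_graph I ->
  injective f -> injective g ->
  (image_edges H f == image_edges I g) = (copy_of H f == copy_of I g).
Proof.
move=> m_gt1 Hc Ic f_inj g_inj; apply/eqP/eqP => [eqE|]; last first.
  by case=> _ eqG; rewrite -!edges_image_graph //; congr edges; apply: val_inj.
congr pair; last by apply: edges_inj; rewrite !edges_image_graph.
apply/eqP; rewrite finset.eqEsubset (connected_image_sub _ _ _ _ eqE) //.
exact: connected_image_sub (esym eqE).
Qed.

Lemma copy_of_iso m n (H I : sgraph m) (f g : {ffun 'I_m -> 'I_n}) :
  injective f -> injective g -> copy_of H f = copy_of I g -> graph_iso H I.
Proof.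
move=> f_inj g_inj [eqV eqG].
have {}eqG : image_graph H f = image_graph I g by apply: val_inj; exact: eqG.
have [s fs] := image_perm g_inj f_inj (esym eqV).
apply/existsP; exists s; apply/forallP => x; apply/forallP => y.
by rewrite -(image_graphE I _ _ g_inj) -!fs -eqG image_graphE.
Qed.

(* Growing X by one vertex along an edge leaving X uses up at least one edge. *)
Lemma connected_edges_outside m (H : sgraph m) (X : {set 'I_m}) x0 :
  connected_graph H -> x0 \in X ->
  (#|~: X| <= #|[set e in edges H | ~~ ((e.1 \in X) && (e.2 \in X))]|)%N.
Proof.
move=> Hc; move: {2}#|~: X| (erefl #|~: X|) => k.
elim: k X => [|k IHk] X cardX x0X; first by rewrite cardX.
have [x [y [xX yX Hxy]]] : exists x y, [/\ x \in X, y \notin X & H x y].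
  have [z] : exists z, z \in ~: X by apply/card_gt0P; rewrite cardX.
  rewrite inE => zX; have /connectP[p Hp ez] := Hc x0 z.
  elim: p {IHk} x0 x0X Hp ez => [|y p IHp] x0 x0X.
    by move=> _ ez; rewrite ez x0X in zX.
  move=> /= /andP[Hxy Hp] ez.
  by have [yX|yX] := boolP (y \in X); [exact: (IHp y)|exists x0, y].
have cardyX : #|~: (y |: X)| = k.
  have := cardsD1 y (~: X); rewrite cardX inE yX add1n => -[->].
  by apply: eq_card => z; rewrite !inE negb_or.
have {IHk} := IHk _ cardyX (setU1r _ x0X); rewrite cardyX cardX => le_k.
apply: leq_ltn_trans le_k _; apply: proper_card; apply/properP; split.
  apply/fintype.subsetP => e; rewrite !inE => /andP[-> /=].
  by apply: contra => /andP[-> ->]; rewrite !orbT.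
exists (sorted_pair x y).
  rewrite inE mem_edges /sorted_pair; case: (ltngtP x y) => /= [xy|yx|/val_inj exy].
  - by rewrite xy Hxy (negbTE yX) andbF.
  - by rewrite yx sgraph_sym Hxy (negbTE yX).
  - by rewrite exy sgraph_irr in Hxy.
by rewrite !inE /sorted_pair; case: ifP => _ /=; rewrite xX !eqxx ?orbT /= andbF.
Qed.

(** If the edges [F] live on [U], every image edge with an endpoint outside [U] is new. A connected
    graph touching [U] thus brings at least as many new edges as new vertices, and vertices minus
    edges cannot grow. *)
Lemma connected_image_outside m n (H : sgraph m) (f : {ffun 'I_m -> 'I_n})
    (U : {set 'I_n}) (F : {set 'I_n * 'I_n}) x0 :
  connected_graph H -> injective f -> f x0 \in U ->
  (forall e, e \in F -> (e.1 \in U) && (e.2 \in U)) ->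
  (#|[set f x | x in 'I_m] :\: U| <= #|image_edges H f :\: F|)%N.
Proof.
move=> Hc f_inj x0U FU; pose X := [set x | f x \in U].
have -> : [set f x | x in 'I_m] :\: U = f @: (~: X).
  apply/setP => i; apply/setDP/imsetP => [[/imsetP[x _ ->] xU]|[x]].
    by exists x; rewrite // !inE.
  by rewrite !inE => xU ->; rewrite imset_f.
rewrite card_imset //.
have x0X : x0 \in X by rewrite inE.
apply: leq_trans (connected_edges_outside Hc x0X) _.
set E' := [set e in _ | _].
have E'inj : {in E' &, injective (fun e => sorted_pair (f e.1) (f e.2))}.
  move=> d e; rewrite !inE -!mem_edges => /andP[dH _] /andP[eH _].
  move=> deq; exact: (sorted_pair_inj f_inj dH eH deq).
rewrite -(card_in_imset E'inj); apply/subset_leq_card/fintype.subsetP => d.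
move=> /imsetP[e]; rewrite inE => /andP[eH /negP eX] ->{d}.
rewrite inE; apply/andP; split; last first.
  by apply/imsetP; exists e.
apply/negP => /FU eU; apply: eX; rewrite !inE.
by move: eU; rewrite /sorted_pair; case: ifP => //= _; rewrite andbC.
Qed.

(** * Unions of four embedded trees *)

Lemma card_setU_outside (T : finType) (A B : {set T}) :
  #|A :|: B| = (#|A :\: B| + #|B|)%N.
Proof.
rewrite -(cardsID B (A :|: B)) finset.setIC finset.setKU addnC; congr (_ + _)%N.
by rewrite finset.setDUl finset.setDv finset.setU0.
Qed.

(* Take [X] maximal for the bound: a further member meeting its vertices could be added. *)
Lemma spanning_subfamily (T : finType) m n (H : T -> sgraph m)
    (f : T -> {ffun 'I_m -> 'I_n}) (t0 : T) :
  (0 < m)%N -> (forall t, connected_graph (H t)) -> (forall t, injective (f t)) ->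
  exists2 X : {set T}, t0 \in X &
    (#|\bigcup_(t in X) [set f t x | x in 'I_m]|
       <= #|\bigcup_(t in X) image_edges (H t) (f t)| + 1)%N /\
    forall t, t \notin X ->
      [disjoint [set f t x | x in 'I_m]
        & \bigcup_(u in X) [set f u x | x in 'I_m]].
Proof.
move=> m_gt0 Hc f_inj; pose x0 := Ordinal m_gt0.
pose V t := [set f t x | x in 'I_m]; pose E t := image_edges (H t) (f t).
pose P (X : {set T}) := (t0 \in X) &&
  (#|\bigcup_(t in X) V t| <= #|\bigcup_(t in X) E t| + 1)%N.
have P0 : P [set t0].
  rewrite /P !big_set1 finset.set11 /=.
  (* With [U] a single vertex and [F] empty this reads [|V| - 1 <= |E|], the source of the [+ 1]. *)
  have := @connected_image_outside m n (H t0) (f t0) [set f t0 x0] finset.set0 x0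
    (Hc t0) (f_inj t0).
  rewrite finset.set11 finset.setD0 => /(_ isT) le1.
  have := cardsD1 (f t0 x0) (V t0); rewrite imset_f // => ->.
  rewrite addnC leq_add2r; apply: le1 => e; by rewrite inE.
have [X /maxsetP[PX maxX]] := ex_maxset (ex_intro P _ P0).
have /andP[t0X le1] := PX; exists X => //; split=> // t tX.
apply/negP => /negP; rewrite -finset.setI_eq0 => /set0Pn[_ /setIP[/imsetP[x _ ->] xU]].
have : t |: X = X.
  apply: maxX; last exact: finset.subsetUr.
  rewrite /P inE t0X orbT !big_setU1 //= !card_setU_outside -addnA leq_add //.
  apply: (connected_image_outside (Hc t) (f_inj t) xU) => e.
  case/bigcupP => u uX /image_edges_verts /andP[e1 e2].
  by apply/andP; split; apply/bigcupP; exists u.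
by move/setP/(_ t); rewrite finset.setU11 (negbTE tX).
Qed.

Lemma image_edges_nonempty m n (H : sgraph m) (f : {ffun 'I_m -> 'I_n}) :
  (1 < m)%N -> connected_graph H -> exists e, e \in image_edges H f.
Proof.
move=> m_gt1 Hc; have [y Hxy] := connected_incident (Ordinal (ltnW m_gt1)) m_gt1 Hc.
move: (Ordinal _) Hxy => x Hxy; case: (ltngtP x y) => [xy|yx|/val_inj xy].
- by eexists; apply/imsetP; exists (x, y); rewrite ?mem_edges /= ?xy.
- by eexists; apply/imsetP; exists (y, x); rewrite ?mem_edges /= ?yx // sgraph_sym.
- by rewrite xy sgraph_irr in Hxy.
Qed.

(** A tree in [X] and a tree outside [X] share no vertex, so the second tree covering an edge is
    always on the same side of the split. Neither side can then be a single tree, and [X], which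
    contains the first tree, is everything or a pair. When only two trees are on a side, each edge
    of one belongs to the other. *)
Lemma doubly_covered_cases m n (H I : sgraph m) (f1 f2 g1 g2 : {ffun 'I_m -> 'I_n}) :
  let A1 := image_edges H f1 in let B1 := image_edges H f2 in
  let A2 := image_edges I g1 in let B2 := image_edges I g2 in
  (1 < m)%N -> connected_graph H -> connected_graph I ->
  injective f1 -> injective f2 -> injective g1 -> injective g2 ->
  (forall e, e \in A1 :|: A2 :|: (B1 :|: B2) ->
    (1 < ((e \in A1) + (e \in A2)) + ((e \in B1) + (e \in B2)))%N) ->
  [\/ (#|[set f1 x | x in 'I_m] :|: [set g1 x | x in 'I_m]
        :|: ([set f2 x | x in 'I_m] :|: [set g2 x | x in 'I_m])|
       <= #|A1 :|: A2 :|: (B1 :|: B2)| + 1)%N,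
      [disjoint A1 :|: B1 & A2 :|: B2],
      [/\ A1 = A2, B1 = B2 & [disjoint A1 & B1]]
    | [/\ A1 = B2, B1 = A2 & [disjoint A1 & B1]]].
Proof.
move=> A1 B1 A2 B2 m_gt1 Hc Ic f1i f2i g1i g2i cover.
(* The first component selects the tree, the second the graph (A or B) in which it is embedded. *)
pose G (t : bool * bool) := if t.1 then I else H.
pose f (t : bool * bool) := if t.1 then if t.2 then g2 else g1
                            else if t.2 then f2 else f1.
pose E t := image_edges (G t) (f t).
have Gc t : connected_graph (G t) by rewrite /G; case: ifP.
have fi t : injective (f t) by rewrite /f; case: t => [[] []].
have [X t0X [le1 disj]] := spanning_subfamily (false, false) (ltnW m_gt1) Gc fi.
have sep t t' e : t \in X -> t' \notin X -> e \in E t -> e \in E t' -> False.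
  move=> tX t'X /image_edges_verts/andP[e1 _] /image_edges_verts/andP[e1' _].
  have := disj _ t'X; rewrite -finset.setI_eq0 => /eqP/setP/(_ e.1).
  by rewrite !inE e1' /= => /bigcupP; apply; exists t.
have EA1 : E (false, false) = A1 by [].
have EB1 : E (false, true) = B1 by [].
have EA2 : E (true, false) = A2 by [].
have EB2 : E (true, true) = B2 by [].
have bigU (S : finType) (F : bool * bool -> {set S}) :
    \bigcup_(t : bool * bool) F t = F (false, false) :|: F (true, false)
     :|: (F (false, true) :|: F (true, true)).
  transitivity (\bigcup_(a : bool) \bigcup_(b : bool) F (a, b)).
    by rewrite pair_bigA /=; apply: eq_bigr => -[].
  rewrite !big_bool /=.
  rewrite finset.setUC [F (true, true) :|: _]finset.setUC.
  by rewrite [F (false, true) :|: _]finset.setUC finset.setUACA.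
have neE t : exists e, e \in E t by exact: image_edges_nonempty.
have {}cover t e : e \in E t -> exists2 t', t' != t & e \in E t'.
  move=> et; have : e \in A1 :|: A2 :|: (B1 :|: B2).
    rewrite !inE; case: t et => [[] []]; rewrite ?EA1 ?EB1 ?EA2 ?EB2 => ->;
      by rewrite ?orbT.
  move/cover; rewrite -EA1 -EB1 -EA2 -EB2 => cnt.
  have [/existsP[t' /andP[t't et']]|/existsPn no] :=
    boolP [exists t', (t' != t) && (e \in E t')]; first by exists t'.
  have out t' : t' != t -> (e \in E t') = false.
    by move=> t't; have := no t'; rewrite t't /= => /negbTE.
  by case: t et out {no} cnt => [[] []] -> out; rewrite !out.
have same t e : e \in E t ->
    exists t', [/\ t' != t, (t' \in X) = (t \in X) & e \in E t'].
  move=> et; have [t' t't et'] := cover _ _ et; exists t'; split=> //.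
  have [tX|tX] := boolP (t \in X); have [t'X|t'X] := boolP (t' \in X) => //.
    by case: (sep t t' e).
  by case: (sep t' t e).
have lone t : (forall t', t' != t -> (t' \in X) = (t \in X) -> False) -> False.
  move=> no; have [e /same[t' [t't t'X _]]] := neE t; exact: (no t').
have pair t u : t != u ->
    (forall t', t' != t -> t' != u -> (t' \in X) = (t \in X) -> False) ->
    (t \in X) = (u \in X) -> E t = E u.
  move=> tu no tuX; apply/setP => e; apply/idP/idP => /same[t' [t'1 t'X et']].
    have [<- //|t'u] := eqVneq t' u; by case: (no t').
  have [<- //|t't] := eqVneq t' t; case: (no t') => //; by rewrite t'X.
have disjA1B1 : (false, true) \in X = false -> [disjoint A1 & B1].
  move=> B1X; rewrite -finset.setI_eq0; apply/eqP/setP => e; rewrite !inE.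
  apply/negP => /andP[e1 e2].
  by apply: (sep (false, false) (false, true) e); rewrite ?B1X.
(* Eight possible [X]; the four that leave a single tree on one side are refuted by [lone]. *)
have [B1X|/negbTE B1X] := boolP ((false, true) \in X);
have [A2X|/negbTE A2X] := boolP ((true, false) \in X);
have [B2X|/negbTE B2X] := boolP ((true, true) \in X).
- constructor 1; have XT : X = [set: bool * bool].
    by apply/setP => -[[] []]; rewrite inE.
  have bigT (S : finType) (F : bool * bool -> {set S}) :
      \bigcup_(t in X) F t = \bigcup_t F t.
    by apply: eq_bigl => t; rewrite XT inE.
  by move: le1; rewrite !bigT !bigU.
- by case: (lone (true, true)) => -[[] []]; rewrite ?t0X ?B1X ?A2X ?B2X.
- by case: (lone (true, false)) => -[[] []]; rewrite ?t0X ?B1X ?A2X ?B2X.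
- constructor 2; rewrite -finset.setI_eq0; apply/eqP/setP => e; rewrite !inE.
  apply/negP => /andP[/orP[e1|e1] /orP[e2|e2]].
  + by apply: (sep (false, false) (true, false) e); rewrite ?A2X.
  + by apply: (sep (false, false) (true, true) e); rewrite ?B2X.
  + by apply: (sep (false, true) (true, false) e); rewrite ?A2X.
  + by apply: (sep (false, true) (true, true) e); rewrite ?B2X.
- by case: (lone (false, true)) => -[[] []]; rewrite ?t0X ?B1X ?A2X ?B2X.
- constructor 3; split.
    apply: (pair (false, false) (true, false)); rewrite ?t0X ?A2X //.
    by move=> -[[] []]; rewrite ?t0X ?B1X ?A2X ?B2X.
    apply: (pair (false, true) (true, true)); rewrite ?B1X ?B2X //.
    by move=> -[[] []]; rewrite ?t0X ?B1X ?A2X ?B2X.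
  exact: disjA1B1.
- constructor 4; split.
    apply: (pair (false, false) (true, true)); rewrite ?t0X ?B2X //.
    by move=> -[[] []]; rewrite ?t0X ?B1X ?A2X ?B2X.
    apply: (pair (false, true) (true, false)); rewrite ?B1X ?A2X //.
    by move=> -[[] []]; rewrite ?t0X ?B1X ?A2X ?B2X.
  exact: disjA1B1.
- by case: (lone (false, false)) => -[[] []]; rewrite ?t0X ?B1X ?A2X ?B2X.
Qed.

(** * Isomorphism classes of trees and their representatives *)

Lemma graph_iso_refl m (H : sgraph m) : graph_iso H H.
Proof.
apply/existsP; exists 1%g; apply/forallP => x; apply/forallP => y.
by rewrite !perm1.
Qed.

Lemma graph_iso_sym m (H I : sgraph m) : graph_iso H I -> graph_iso I H.
Proof.
case/existsP => s /forallP HI; apply/existsP; exists (s^-1)%g.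
apply/forallP => x; apply/forallP => y.
by have /forallP/(_ ((s^-1)%g y))/eqP := HI ((s^-1)%g x); rewrite !permKV => ->.
Qed.

Lemma graph_iso_trans m (H I J : sgraph m) :
  graph_iso H I -> graph_iso I J -> graph_iso H J.
Proof.
case/existsP => s /forallP HI /existsP[t /forallP IJ]; apply/existsP.
exists (s * t)%g; apply/forallP => x; apply/forallP => y; rewrite !permM.
have /forallP/(_ (s y))/eqP -> := IJ (s x).
by have /forallP/(_ y) := HI x.
Qed.

Lemma graph_iso_equivalence K :
  {in trees K & &, equivalence_rel (@graph_iso K.+1)}.
Proof.
move=> H I J _ _ _; split; first exact: graph_iso_refl.
move=> HI; apply/idP/idP; apply: graph_iso_trans => //; exact: graph_iso_sym.
Qed.

Lemma tree_reprs_transversal K :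
  is_transversal (tree_reprs K) (unlabeled_trees K) (trees K).
Proof.
by apply: transversalP; apply: equivalence_partitionP; exact: graph_iso_equivalence.
Qed.

Lemma card_tree_reprs K : #|tree_reprs K| = #|unlabeled_trees K|.
Proof. exact: card_transversal (tree_reprs_transversal K). Qed.

Lemma tree_reprs_tree K H : H \in tree_reprs K -> is_tree H /\ #|edges H| = K.
Proof.
move=> Hr; have := fintype.subsetP (transversal_sub (tree_reprs_transversal K)) _ Hr.
by rewrite inE => /andP[/asboolP Ht /eqP].
Qed.

Lemma tree_reprs_iso K H I : H \in tree_reprs K -> I \in tree_reprs K ->
  graph_iso H I -> H = I.
Proof.
move=> Hr Ir HI; have tr := tree_reprs_transversal K.
have sub := fintype.subsetP (transversal_sub tr).
apply: (pblock_inj tr) => //; apply: same_pblock.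
  by case/and3P: (equivalence_partitionP (@graph_iso_equivalence K)).
rewrite (pblock_equivalence_partition (@graph_iso_equivalence K)) ?sub //.
by apply: graph_iso_sym.
Qed.

(** The star centred at [ord0] shows that there is a tree for every [K]. The positivity of the mean,
    and later of Otter's constant, rests on it. *)
Lemma star_adjacency K : is_adjacency
  (\matrix_(i < K.+1, j < K.+1) ((i != j) && ((i == ord0) || (j == ord0)))).
Proof.
apply/andP; split; first by apply/forallP => i; rewrite mxE eqxx.
by apply/forallP => i; apply/forallP => j; rewrite !mxE (eq_sym i) orbC.
Qed.

Definition star K : sgraph K.+1 := SGraph (star_adjacency K).

Lemma starE K i j : star K i j = (i != j) && ((i == ord0) || (j == ord0)).
Proof. by rewrite mxE. Qed.

Lemma star_tree K : star K \in trees K.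
Proof.
rewrite inE; apply/andP; split.
  apply/asboolP; split=> [x y|].
    have to0 z : connect (fun i j => star K i j) z ord0.
      have [->|z0] := eqVneq z ord0; first exact: connect0.
      by apply: connect1; rewrite starE z0 eqxx orbT.
    have from0 z : connect (fun i j => star K i j) ord0 z.
      have [->|z0] := eqVneq z ord0; first exact: connect0.
      by apply: connect1; rewrite starE eq_sym z0 eqxx.
    exact: connect_trans (to0 x) (from0 y).
  case=> [|a [|b [|d c]]] // _ /andP[/= /and3P[]]; rewrite !starE.
  move=> /andP[ab ab0] /andP[bd bd0] cyc.
  rewrite !inE !negb_or => /and3P[/and3P[_ ad ac] /andP[_ bc] _].
  (* If [b] is not the centre, both of its neighbours on the cycle are, against uniqueness. If it
     is, [d] is a leaf, and the vertex after [d] would have to be the centre a second time. *)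
  case: (eqVneq b ord0) => [b0|b0]; last first.
    move: ab0 bd0; rewrite (negbTE b0) orbF => /eqP a0 /= /eqP d0.
    by rewrite a0 d0 eqxx in ad.
  move: ad bd bc ab; rewrite b0 eq_sym => ad d0 c0 a0.
  case: c cyc c0 ac => [|x c] /=; rewrite starE => /andP[/andP[_]] //.
    by rewrite eq_sym (negbTE d0) (negbTE a0).
  by rewrite eq_sym (negbTE d0) /= => /eqP ->; rewrite inE eqxx.
have -> : edges (star K) = [set (ord0, lift ord0 j) | j in 'I_K].
  apply/setP => -[i j]; rewrite mem_edges starE /=; apply/andP/imsetP.
    move=> [ij /andP[_ /orP[/eqP i0|/eqP j0]]]; last by rewrite j0 ltn0 in ij.
    have := ij; rewrite i0; case: (unliftP ord0 j) => [k -> _|->]; last by rewrite ltnn.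
    by exists k.
  by case=> k _ [-> ->]; rewrite eqxx.
by rewrite card_imset ?card_ord // => j k /(congr1 snd) /= /lift_inj.
Qed.

Lemma unlabeled_trees_gt0 K : (0 < #|unlabeled_trees K|)%N.
Proof.
have /and3P[/eqP cov _ _] := equivalence_partitionP (@graph_iso_equivalence K).
have := star_tree K; rewrite -cov => /bigcupP[B BU _].
by apply/card_gt0P; exists B.
Qed.

(** * The coupled law *)

Definition coupled_pmf (R : realType) n (q rho : R) (AB : sgraph n * sgraph n) : R :=
  \prod_(e : 'I_n * 'I_n | (e.1 < e.2)%N)
    corr_bern q rho (AB.1 e.1 e.2) (AB.2 e.1 e.2).

Lemma graph_of_adjacency n (h : 'I_n * 'I_n -> bool) : is_adjacency
  (\matrix_(i, j) (if (i < j)%N then h (i, j) else (j < i)%N && h (j, i))).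
Proof.
apply/andP; split; first by apply/forallP => i; rewrite mxE ltnn.
apply/forallP => i; apply/forallP => j; rewrite !mxE.
by case: ltngtP.
Qed.

Definition graph_of n (h : 'I_n * 'I_n -> bool) : sgraph n :=
  SGraph (graph_of_adjacency h).

Lemma graph_ofE n (h : 'I_n * 'I_n -> bool) (e : 'I_n * 'I_n) :
  (e.1 < e.2)%N -> graph_of h e.1 e.2 = h e.
Proof. by case: e => i j /= ij; rewrite mxE ij. Qed.

Lemma eq_edges n (G G' : sgraph n) :
  (forall e : 'I_n * 'I_n, (e.1 < e.2)%N -> G e.1 e.2 = G' e.1 e.2) -> G = G'.
Proof.
move=> eqG; apply: edges_inj; apply/setP => e; rewrite !mem_edges.
by case: (ltnP e.1 e.2) => //= /eqG.
Qed.

(** A pair of graphs is a free choice of two bits at each [i < j], so the identity is distributivity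
    of the product over the sum. Independence across vertex pairs enters the proof in this form. *)
Lemma sum_graph_pairs (R : comRingType) n (phi : 'I_n * 'I_n -> bool -> bool -> R) :
  \sum_(AB : sgraph n * sgraph n)
     \prod_(e : 'I_n * 'I_n | (e.1 < e.2)%N) phi e (AB.1 e.1 e.2) (AB.2 e.1 e.2) =
  \prod_(e : 'I_n * 'I_n | (e.1 < e.2)%N) \sum_(a : bool) \sum_(b : bool) phi e a b.
Proof.
under [RHS]eq_bigr do rewrite pair_bigA /=.
pose lt := fun e : 'I_n * 'I_n => (e.1 < e.2)%N.
rewrite (big_distr_big (false, false)) /=.
pose to (AB : sgraph n * sgraph n) : {ffun 'I_n * 'I_n -> bool * bool} :=
  [ffun e : 'I_n * 'I_n => if lt e then (AB.1 e.1 e.2, AB.2 e.1 e.2) else (false, false)].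
pose from (h : {ffun 'I_n * 'I_n -> bool * bool}) :=
  (graph_of (fun e => (h e).1), graph_of (fun e => (h e).2)).
rewrite (reindex_onto to from) /=; last first.
  move=> h /pffun_onP[/supportP hlt _]; apply/ffunP => e; rewrite ffunE.
  case: ifP => [lte|/negbT nlt]; last by rewrite hlt.
  rewrite -[(from h).1]/(graph_of _) -[(from h).2]/(graph_of _) !graph_ofE //.
  by case: (h e).
apply: eq_big => [[A B]|[A B] _] /=; last first.
  by apply: eq_bigr => e lte; rewrite ffunE /lt lte.
symmetry; apply/andP; split.
  apply/pffun_onP; split; last by [].
  by apply/supportP => e nlt; rewrite ffunE; case: ifP => // lte; case/negP: nlt.
apply/eqP; congr pair; apply: eq_edges => e lte; last first.
  by rewrite graph_ofE // ffunE /lt lte.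
by rewrite graph_ofE // ffunE /lt lte.
Qed.

(** * Joint moments of centered edges *)

(** The masses of (1,1) and (0,0) factor as [q (q + rho (1 - q))] and [(1 - q) ((1 - q) + rho q)],
    which are nonnegative exactly under the lower bound on [rho]; [rho <= 1] serves the two mixed
    outcomes. *)
Lemma corr_bern_ge0 (R : realType) (q rho : R) a b : 0 < q < 1 ->
  - Num.min (q / (1 - q)) ((1 - q) / q) <= rho <= 1 -> 0 <= corr_bern q rho a b.
Proof.
move=> /andP[q0 q1] /andP[rho_ge rho_le].
have q1' : 0 < 1 - q by rewrite subr_gt0.
have h1 : 0 <= q + rho * (1 - q).
  have : - (q / (1 - q)) <= rho.
    by apply: le_trans rho_ge; rewrite lerN2 ge_min lexx.
  by rewrite -mulNr ler_pdivrMr //; lra.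
have h2 : 0 <= (1 - q) + rho * q.
  have : - ((1 - q) / q) <= rho.
    by apply: le_trans rho_ge; rewrite lerN2 ge_min lexx orbT.
  by rewrite -mulNr ler_pdivrMr //; lra.
rewrite /corr_bern /bern; case: a; case: b => /=.
- by have := mulr_ge0 (ltW q0) h1; lra.
- by have := mulr_ge0 (mulr_ge0 (ltW q0) (ltW q1')) (_ : 0 <= 1 - rho); lra.
- by have := mulr_ge0 (mulr_ge0 (ltW q0) (ltW q1')) (_ : 0 <= 1 - rho); lra.
- by have := mulr_ge0 (ltW q1') h2; lra.
Qed.

(** Here [m] and [l] count the trees through one edge on the A side and on the B side; each is at
    most 2. *)
Definition edge_moment (R : realType) (q rho : R) (m l : nat) : R :=
  \sum_(a : bool) \sum_(b : bool)
    corr_bern q rho a b * ((a%:R - q) ^+ m * (b%:R - q) ^+ l).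

Section EdgeMoment.
Variables (R : realType) (q rho : R).

Lemma edge_moment00 : edge_moment q rho 0 0 = 1.
Proof. by rewrite /edge_moment !big_bool /corr_bern /bern /=; ring. Qed.

Lemma edge_moment10 : edge_moment q rho 1 0 = 0.
Proof. by rewrite /edge_moment !big_bool /corr_bern /bern /=; ring. Qed.

Lemma edge_moment01 : edge_moment q rho 0 1 = 0.
Proof. by rewrite /edge_moment !big_bool /corr_bern /bern /=; ring. Qed.

Lemma edge_moment11 : edge_moment q rho 1 1 = rho * (q * (1 - q)).
Proof. by rewrite /edge_moment !big_bool /corr_bern /bern /=; ring. Qed.

Lemma edge_moment1_indep l : edge_moment q 0 1 l = 0.
Proof. by rewrite /edge_moment !big_bool /corr_bern /bern /=; ring. Qed.

Lemma edge_moment_indep1 m : edge_moment q 0 m 1 = 0.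
Proof. by rewrite /edge_moment !big_bool /corr_bern /bern /=; ring. Qed.

(** Centered entries are at most 1 in absolute value, so an exponent 2 on one side dominates the
    monomial by a square, whose mean is the variance [q (1 - q)]. For [m = l = 1] the half sum of
    the two squares does the same. *)
Lemma edge_moment_norm m l : 0 < q < 1 -> (forall a b, 0 <= corr_bern q rho a b) ->
  (m <= 2)%N -> (l <= 2)%N -> (1 < m + l)%N ->
  `|edge_moment q rho m l| <= q * (1 - q).
Proof.
move=> /andP[q0 q1] p0 m2 l2 ml.
have x1 (a : bool) : `|a%:R - q| <= 1.
  by rewrite ler_norml; case: a => /=; apply/andP; split; lra.
have le1 (a b : bool) : `|(a%:R - q) ^+ m * (b%:R - q) ^+ l| <=
    if m == 2 then (a%:R - q) ^+ 2 else
    if l == 2 then (b%:R - q) ^+ 2 else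
    2^-1 * (a%:R - q) ^+ 2 + 2^-1 * (b%:R - q) ^+ 2.
  have xn (c : bool) k : `|c%:R - q| ^+ k <= 1 by rewrite exprn_ile1.
  rewrite normrM !normrX; case: eqP => [->|m2'].
    by rewrite -[leRHS]mulr1 -(real_normK (num_real (a%:R - q))) ler_wpM2l ?sqr_ge0.
  case: eqP => [->|l2'].
    by rewrite -[leRHS]mul1r -(real_normK (num_real (b%:R - q))) ler_wpM2r ?sqr_ge0.
  have [-> ->] : m = 1%N /\ l = 1%N by lia.
  rewrite !expr1 -(real_normK (num_real (a%:R - q))) -(real_normK (num_real (b%:R - q))).
  by have := sqr_ge0 (`|a%:R - q| - `|b%:R - q|); lra.
have -> : q * (1 - q) = \sum_(a : bool) \sum_(b : bool) corr_bern q rho a b *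
    (if m == 2 then (a%:R - q) ^+ 2 else
     if l == 2 then (b%:R - q) ^+ 2 else
     2^-1 * (a%:R - q) ^+ 2 + 2^-1 * (b%:R - q) ^+ 2).
  by rewrite !big_bool /corr_bern /bern /=; case: ifP => _; [|case: ifP => _]; field.
apply: le_trans (ler_norm_sum _ _ _) _; apply: ler_sum => a _.
apply: le_trans (ler_norm_sum _ _ _) _; apply: ler_sum => b _.
by rewrite normrM (ger0_norm (p0 a b)) ler_wpM2l.
Qed.

End EdgeMoment.

Definition centered_prod (R : realType) n (q : R) (E : {set 'I_n * 'I_n})
    (G : sgraph n) : R :=
  \prod_(e in E) ((G e.1 e.2)%:R - q).

Definition sorted_edges n (E : {set 'I_n * 'I_n}) :=
  forall e, e \in E -> (e.1 < e.2)%N.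

(** The mean of a product of four centered monomials, already factored over vertex pairs; a pair
    outside all four sets contributes 1. *)
Definition joint_moment (R : realType) n (q rho : R)
    (A1 A2 B1 B2 : {set 'I_n * 'I_n}) : R :=
  \prod_(e : 'I_n * 'I_n | (e.1 < e.2)%N)
    edge_moment q rho ((e \in A1) + (e \in A2)) ((e \in B1) + (e \in B2)).

Lemma sorted_edges_diff n (A B : {set 'I_n * 'I_n}) :
  sorted_edges A -> sorted_edges B -> A != B ->
  exists2 e : 'I_n * 'I_n, (e.1 < e.2)%N & ((e \in A) + (e \in B) = 1)%N.
Proof.
move=> Alt Blt AB; have [e eAB] : exists e, (e \in A) != (e \in B).
  apply/existsP; apply: contraNT AB => /existsPn eqAB; apply/eqP/setP => e.
  by have := eqAB e; rewrite negbK => /eqP.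
exists e; last by move: eAB; case: (e \in A); case: (e \in B).
by move: eAB; case: (boolP (e \in A)) => [/Alt|_] //; case: (boolP (e \in B)) => [/Blt|].
Qed.

Lemma centered_prodE (R : realType) n (q : R) (E : {set 'I_n * 'I_n}) G :
  sorted_edges E ->
  centered_prod q E G =
  \prod_(e : 'I_n * 'I_n | (e.1 < e.2)%N) ((G e.1 e.2)%:R - q) ^+ (e \in E).
Proof.
move=> Elt; rewrite /centered_prod big_mkcond [RHS]big_mkcond.
apply: eq_bigr => e _; case: ifP => [/Elt ->|_]; first by rewrite expr1.
by case: ifP.
Qed.

Section JointMoment.
Variables (R : realType) (n : nat) (q rho : R).
Implicit Types A B : {set 'I_n * 'I_n}.

Lemma mean_centered_prod A1 A2 B1 B2 :
  sorted_edges A1 -> sorted_edges A2 -> sorted_edges B1 -> sorted_edges B2 ->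
  mean (coupled_pmf q rho)
    (fun AB => centered_prod q A1 AB.1 * centered_prod q A2 AB.1 *
       (centered_prod q B1 AB.2 * centered_prod q B2 AB.2)) =
  joint_moment q rho A1 A2 B1 B2.
Proof.
move=> A1lt A2lt B1lt B2lt; rewrite /joint_moment /edge_moment -sum_graph_pairs.
apply: eq_bigr => AB _; rewrite !centered_prodE // -!big_split /=.
by apply: eq_bigr => e _; rewrite !exprD.
Qed.

Lemma joint_moment_lone A1 A2 B1 B2 (e : 'I_n * 'I_n) : (e.1 < e.2)%N ->
  (((e \in A1) + (e \in A2)) + ((e \in B1) + (e \in B2)) = 1)%N ->
  joint_moment q rho A1 A2 B1 B2 = 0.
Proof.
move=> lte; rewrite /joint_moment (bigD1 e) //=.
case: (e \in A1); case: (e \in A2); case: (e \in B1); case: (e \in B2) => //= _;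
  by rewrite ?edge_moment10 ?edge_moment01 mul0r.
Qed.

Lemma joint_moment_norm A1 A2 B1 B2 : 0 < q < 1 ->
  (forall a b, 0 <= corr_bern q rho a b) ->
  (forall e, e \in A1 :|: A2 :|: (B1 :|: B2) ->
    (1 < ((e \in A1) + (e \in A2)) + ((e \in B1) + (e \in B2)))%N) ->
  sorted_edges (A1 :|: A2 :|: (B1 :|: B2)) ->
  `|joint_moment q rho A1 A2 B1 B2|
    <= (q * (1 - q)) ^+ #|A1 :|: A2 :|: (B1 :|: B2)|.
Proof.
move=> q01 p0 cover Ult; set U := _ :|: _ in cover Ult *.
have -> : (q * (1 - q)) ^+ #|U| =
    \prod_(e : 'I_n * 'I_n | (e.1 < e.2)%N) (if e \in U then q * (1 - q) else 1).
  rewrite -big_mkcondr /= -prodr_const; apply: eq_bigl => e.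
  by case: (boolP (e \in U)) => [/Ult ->|]; rewrite ?andbF.
rewrite normr_prod; apply: ler_prod => e lte; rewrite normr_ge0 /=.
case: ifP => [/cover c|/negbT].
  by apply: edge_moment_norm => //; do 2!case: (_ \in _).
rewrite /U !inE !negb_or => /andP[/andP[/negbTE-> /negbTE->] /andP[/negbTE-> /negbTE->]].
by rewrite edge_moment00 normr1.
Qed.

Lemma joint_moment_split A1 A2 B1 B2 : [disjoint A1 :|: B1 & A2 :|: B2] ->
  joint_moment q rho A1 A2 B1 B2 =
  joint_moment q rho A1 finset.set0 B1 finset.set0 *
  joint_moment q rho A2 finset.set0 B2 finset.set0.
Proof.
rewrite -finset.setI_eq0 => /eqP/setP disj; rewrite -big_split /=.
apply: eq_bigr => e _; have := disj e; rewrite !inE !addn0.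
case: (e \in A1); case: (e \in A2); case: (e \in B1); case: (e \in B2) => //= _;
  by rewrite ?edge_moment00 ?mulr1 ?mul1r.
Qed.

Lemma joint_moment_pair A B : sorted_edges A -> sorted_edges B ->
  joint_moment q rho A finset.set0 B finset.set0 =
  (rho * (q * (1 - q))) ^+ #|A| * (A == B)%:R.
Proof.
move=> Alt Blt; have [<-|AB] := eqVneq A B.
  rewrite mulr1 -prodr_const /joint_moment big_mkcond [RHS]big_mkcond /=.
  apply: eq_bigr => e _; rewrite !inE !addn0.
  case: (boolP (e \in A)) => [/Alt ->|_]; first by rewrite edge_moment11.
  by rewrite edge_moment00; case: ifP.
rewrite mulr0; have [e lte one] := sorted_edges_diff Alt Blt AB.
by apply: (joint_moment_lone lte); rewrite !inE !addn0.
Qed.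

(** Equal cardinalities make the power of [rho] a square, whatever the sign of [rho]. An upper bound
    on a covariance may therefore drop the subtracted product. *)
Lemma joint_moment_pair_prod_ge0 A1 A2 B1 B2 :
  sorted_edges A1 -> sorted_edges A2 -> sorted_edges B1 -> sorted_edges B2 ->
  #|A1| = #|A2| ->
  0 <= joint_moment q rho A1 finset.set0 B1 finset.set0 *
       joint_moment q rho A2 finset.set0 B2 finset.set0.
Proof.
move=> A1lt A2lt B1lt B2lt cA; rewrite !joint_moment_pair // cA mulrACA.
apply: mulr_ge0; last by rewrite mulr_ge0.
by rewrite -expr2 sqr_ge0.
Qed.

(** Double counting of the incidences between edges and the four sets. *)
Lemma card_doubly_covered A1 A2 B1 B2 :
  (forall e, e \in A1 :|: A2 :|: (B1 :|: B2) ->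
    (1 < ((e \in A1) + (e \in A2)) + ((e \in B1) + (e \in B2)))%N) ->
  (2 * #|A1 :|: A2 :|: (B1 :|: B2)| <= #|A1| + #|A2| + (#|B1| + #|B2|))%N.
Proof.
move=> cover; have cardE (E : {set 'I_n * 'I_n}) : #|E| = (\sum_e (e \in E))%N.
  by rewrite -sum1_card big_mkcond; apply: eq_bigr => e _; case: (_ \in _).
rewrite !cardE -!big_split /= big_distrr /=; apply: leq_sum => e _.
by case: (boolP (e \in _)) => [/cover|].
Qed.

End JointMoment.

(** For [rho = 0] the two sides separate: an edge met once within A kills the moment even if B
    covers it. No overlap term arises, and the null second moment comes out exactly. *)
Lemma joint_moment_indep (R : realType) n (q : R) (A1 A2 B1 B2 : {set 'I_n * 'I_n}) :
  sorted_edges A1 -> sorted_edges A2 -> sorted_edges B1 -> sorted_edges B2 ->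
  joint_moment q 0 A1 A2 B1 B2 =
  (q * (1 - q)) ^+ (#|A1| + #|B1|) * ((A1 == A2) && (B1 == B2))%:R.
Proof.
move=> A1lt A2lt B1lt B2lt.
have [<-|A12] := eqVneq A1 A2; last first.
  have [e lte one] := sorted_edges_diff A1lt A2lt A12.
  by rewrite mulr0 /joint_moment (bigD1 e) //= one edge_moment1_indep mul0r.
have [<-|B12] := eqVneq B1 B2; last first.
  have [e lte one] := sorted_edges_diff B1lt B2lt B12.
  by rewrite mulr0 /joint_moment (bigD1 e) //= one edge_moment_indep1 mul0r.
have prodE (A : {set 'I_n * 'I_n}) : sorted_edges A -> (q * (1 - q)) ^+ #|A| =
    \prod_(e : 'I_n * 'I_n | (e.1 < e.2)%N) (if e \in A then q * (1 - q) else 1).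
  move=> Alt; rewrite -big_mkcondr /= -prodr_const; apply: eq_bigl => e.
  by case: (boolP (e \in A)) => [/Alt ->|]; rewrite ?andbF.
rewrite mulr1 exprD !prodE // -big_split /=; apply: eq_bigr => e _.
rewrite /edge_moment !big_bool /corr_bern /bern /=.
by case: (e \in A1); case: (e \in B1) => /=; ring.
Qed.

(** * Covariances of embedded trees *)

Lemma centered_sym (R : realType) n (q : R) (G : sgraph n) i j :
  centered q G i j = centered q G j i.
Proof. by rewrite !mxE eq_sym sgraph_sym. Qed.

Lemma relabel_adjacency n (s : 'S_n) (G : sgraph n) :
  is_adjacency (\matrix_(i, j) G (s i) (s j)).
Proof.
apply/andP; split; first by apply/forallP => i; rewrite mxE sgraph_irr.
by apply/forallP => i; apply/forallP => j; rewrite !mxE sgraph_sym.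
Qed.

Definition relabel n (s : 'S_n) (G : sgraph n) : sgraph n :=
  SGraph (relabel_adjacency s G).

Lemma relabelE n (s : 'S_n) (G : sgraph n) i j : relabel s G i j = G (s i) (s j).
Proof. by rewrite mxE. Qed.

Lemma relabelK n (s : 'S_n) : cancel (@relabel n s) (relabel (s^-1)%g).
Proof. by move=> G; apply: sgraph_eqP => i j; rewrite !relabelE !permKV. Qed.

Lemma mean_alt_pmf (R : realType) n (q rho : R) (F : sgraph n * sgraph n -> R) :
  (forall s A B, F (A, relabel s B) = F (A, B)) ->
  mean (alt_pmf q rho) F = mean (coupled_pmf q rho) F.
Proof.
move=> Finv; rewrite /mean /alt_pmf.
under eq_bigr do rewrite big_distrl /=.
rewrite exchange_big /=.
transitivity (\sum_(s : 'S_n) n`!%:R^-1 * mean (coupled_pmf q rho) F).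
  apply: eq_bigr => s _; rewrite /mean big_distrr /=.
  have bij : {on [pred AB : sgraph n * sgraph n | true], bijective
      (fun AB : sgraph n * sgraph n => (AB.1, relabel s AB.2))}.
    exists (fun AB => (AB.1, relabel (s^-1)%g AB.2)) => -[A B] _ /=.
      by rewrite relabelK.
    by rewrite -{1}(invgK s) relabelK.
  rewrite [RHS](reindex _ bij) /=; apply: eq_bigr => -[A B] _ /=.
  rewrite Finv mulrA; congr (_ * _ * _); apply: eq_bigr => e _ /=.
  by rewrite relabelE.
rewrite sumr_const card_Sn -[LHS]mulr_natl mulrA divff ?mul1r //.
Qed.

Lemma embedding_sum_relabel (R : realType) m n (H : sgraph m) (q : R) (s : 'S_n)
    (G : sgraph n) :
  embedding_sum H (centered q (relabel s G)) = embedding_sum H (centered q G).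
Proof.
pose c (s : 'S_n) (f : {ffun 'I_m -> 'I_n}) : {ffun 'I_m -> 'I_n} := [ffun x => s (f x)].
have cK t : cancel (c t) (c (t^-1)%g).
  by move=> f; apply/ffunP => x; rewrite !ffunE permK.
rewrite /embedding_sum [RHS](reindex (c s)) /=; last first.
  exists (c (s^-1)%g) => f _; first exact: cK.
  by rewrite -{1}(invgK s) cK.
apply: eq_big => [f|f _].
  apply/injectiveP/injectiveP => f_inj x y.
    by rewrite !ffunE => /perm_inj /f_inj.
  by move=> fxy; apply: f_inj; rewrite !ffunE fxy.
apply: eq_bigr => e _; rewrite !ffunE !mxE (inj_eq perm_inj).
by case: ifP.
Qed.

Lemma embedding_sum_centered (R : realType) m n (H : sgraph m) (q : R) (G : sgraph n) :
  embedding_sum H (centered q G) =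
  \sum_(f : {ffun 'I_m -> 'I_n} | injectiveb f) centered_prod q (image_edges H f) G.
Proof.
apply: eq_bigr => f /injectiveP f_inj.
rewrite -(big_image_edges _ f_inj); last exact: centered_sym.
apply: eq_bigr => e /image_edges_lt - /(_ f_inj) lte.
by rewrite mxE -val_eqE /= ltn_eqF.
Qed.

(** Each of the two [W] takes a factor [aut H] to become an embedding sum; only one is available,
    hence the division. *)
Lemma f_statE (R : realType) n K (q rho : R) (AB : sgraph n * sgraph n) :
  f_stat K q rho AB = \sum_(H in tree_reprs K)
    beta n K q rho / (Defs.aut H)%:R *
      (embedding_sum H (centered q AB.1) * embedding_sum H (centered q AB.2)).
Proof.
apply: eq_bigr => H _; rewrite !embedding_sumE //; try exact: centered_sym.
have a0 : (Defs.aut H)%:R != 0 :> R by rewrite pnatr_eq0 -lt0n aut_gt0.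
by field.
Qed.

Lemma f_stat_relabel (R : realType) n K (q rho : R) (s : 'S_n) (A B : sgraph n) :
  f_stat K q rho (A, relabel s B) = f_stat K q rho (A, B).
Proof. by rewrite !f_statE; apply: eq_bigr => H _; rewrite embedding_sum_relabel. Qed.

Lemma image_edges_sorted m n (H : sgraph m) (f : {ffun 'I_m -> 'I_n}) :
  injective f -> sorted_edges (image_edges H f).
Proof. by move=> f_inj e; exact: image_edges_lt. Qed.

Lemma bernoulli_variance_bounds (R : realType) (q : R) : 0 < q < 1 ->
  0 <= q * (1 - q) /\ q * (1 - q) <= 1.
Proof. by move=> /andP[q0 q1]; split; nra. Qed.

(** The two indicators pay for the two ways in which the trees can coincide, the last term for a
    union with at least [v - 1] edges; there [v <= 2 * K + 1] because a doubly covered union has at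
    most [2 * K] edges. All terms are nonnegative, so each case uses its own and discards the
    others. *)
Lemma covariance_bound (R : realType) n K (q rho : R) (H I : sgraph K.+1)
    (f1 f2 g1 g2 : {ffun 'I_K.+1 -> 'I_n}) :
  let A1 := image_edges H f1 in let B1 := image_edges H f2 in
  let A2 := image_edges I g1 in let B2 := image_edges I g2 in
  let v := #|[set f1 x | x in 'I_K.+1] :|: [set g1 x | x in 'I_K.+1]
    :|: ([set f2 x | x in 'I_K.+1] :|: [set g2 x | x in 'I_K.+1])| in
  0 < q < 1 -> (forall a b, 0 <= corr_bern q rho a b) -> (0 < K)%N ->
  connected_graph H -> connected_graph I -> #|edges H| = K -> #|edges I| = K ->
  injective f1 -> injective f2 -> injective g1 -> injective g2 ->
  joint_moment q rho A1 A2 B1 B2 -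
    joint_moment q rho A1 finset.set0 B1 finset.set0 *
    joint_moment q rho A2 finset.set0 B2 finset.set0 <=
  (q * (1 - q)) ^+ (2 * K) * (((A1 == A2) && (B1 == B2))%:R
     + ((A1 == B2) && (B1 == A2))%:R)
  + (if (v <= 2 * K + 1)%N then (q * (1 - q)) ^+ v.-1 else 0).
Proof.
move=> A1 B1 A2 B2 v q01 p0 K0 Hc Ic HK IK f1i f2i g1i g2i.
have A1lt : sorted_edges A1 by exact: image_edges_sorted.
have B1lt : sorted_edges B1 by exact: image_edges_sorted.
have A2lt : sorted_edges A2 by exact: image_edges_sorted.
have B2lt : sorted_edges B2 by exact: image_edges_sorted.
have cA1 : #|A1| = K by rewrite card_image_edges.
have cB1 : #|B1| = K by rewrite card_image_edges.
have cA2 : #|A2| = K by rewrite card_image_edges.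
have cB2 : #|B2| = K by rewrite card_image_edges.
have prod0 := @joint_moment_pair_prod_ge0 R n q rho A1 A2 B1 B2 A1lt A2lt B1lt B2lt
  (etrans cA1 (esym cA2)).
have [s0 s1] := bernoulli_variance_bounds q01.
have third0 : 0 <= (if (v <= 2 * K + 1)%N then (q * (1 - q)) ^+ v.-1 else 0).
  by case: ifP => _; rewrite ?exprn_ge0.
have first0 (b1 b2 : bool) : 0 <= (q * (1 - q)) ^+ (2 * K) * (b1%:R + b2%:R).
  by rewrite mulr_ge0 ?exprn_ge0 ?addr_ge0.
set U := A1 :|: A2 :|: (B1 :|: B2).
have Ult : sorted_edges U.
  move=> e; rewrite !inE => /orP[/orP[]|/orP[]];
    [exact: A1lt|exact: A2lt|exact: B1lt|exact: B2lt].
(* An edge covered once makes the joint moment vanish, and minus a nonnegative product remains. *)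
have [/forallP cover|] := boolP [forall e, (e \in U) ==>
  (1 < ((e \in A1) + (e \in A2)) + ((e \in B1) + (e \in B2)))%N]; last first.
  case/forallPn => e; rewrite negb_imply -leqNgt => /andP[eU le1].
  rewrite (joint_moment_lone q rho (Ult _ eU)).
    by rewrite sub0r; apply: le_trans (_ : 0 <= _); rewrite ?oppr_le0 ?addr_ge0.
  by move: eU le1; rewrite !inE; do 4!case: (_ \in _).
have {}cover e : e \in U ->
    (1 < ((e \in A1) + (e \in A2)) + ((e \in B1) + (e \in B2)))%N.
  by apply/implyP.
have jU := joint_moment_norm q01 p0 cover Ult.
have cU := card_doubly_covered cover; rewrite -/U cA1 cB1 cA2 cB2 in cU.
(* The exponent may be lowered from [#|U|] to [k] because [q * (1 - q) <= 1]. *)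
have jle k : (k <= #|U|)%N -> joint_moment q rho A1 A2 B1 B2 -
    joint_moment q rho A1 finset.set0 B1 finset.set0 *
    joint_moment q rho A2 finset.set0 B2 finset.set0 <= (q * (1 - q)) ^+ k.
  move=> kU; rewrite lerBlDr; apply: le_trans (ler_norm _) _.
  apply: le_trans jU _; apply: le_trans (_ : (q * (1 - q)) ^+ k <= _).
    by apply: ler_wiXn2l.
  by rewrite lerDl.
have cardU2 : [disjoint A1 & B1] -> U = A1 :|: B1 -> #|U| = (2 * K)%N.
  move=> /disjoint_setI0 disj ->; rewrite cardsU disj cards0 cA1 cB1; lia.
have [vU|disj|[A12 B12 disj]|[AB BA disj]] :=
  @doubly_covered_cases K.+1 n H I f1 f2 g1 g2 (K0 : (1 < K.+1)%N)
    Hc Ic f1i f2i g1i g2i cover.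
- rewrite -/v -/U in vU; have -> : (v <= 2 * K + 1)%N by lia.
  by apply: le_trans (jle v.-1 _) _; [lia|rewrite lerDr].
- by rewrite joint_moment_split // subrr addr_ge0.
- rewrite -/A1 -/A2 -/B1 -/B2 in A12 B12 disj.
  apply: le_trans (jle (2 * K)%N _) _.
    by rewrite cardU2 // /U -A12 -B12 !finset.setUid.
  rewrite -A12 -B12 !eqxx -[leLHS]addr0 lerD // ler_peMr ?exprn_ge0 //.
  by rewrite lerDl.
- rewrite -/A1 -/A2 -/B1 -/B2 in AB BA disj.
  apply: le_trans (jle (2 * K)%N _) _.
    rewrite cardU2 // /U -AB -BA [B1 :|: A1]finset.setUC; exact: finset.setUid.
  rewrite -AB -BA !eqxx -[leLHS]addr0 lerD // ler_peMr ?exprn_ge0 //.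
  by rewrite lerDr.
Qed.

(** * Moments of the test statistic *)

(** Equal images force an isomorphism, hence [I = H] among representatives; what is left to count is
    the fibre of [card_copy_fiber]. *)
Lemma card_same_image n K (H I : sgraph K.+1) (f : {ffun 'I_K.+1 -> 'I_n}) :
  (0 < K)%N -> H \in tree_reprs K -> I \in tree_reprs K -> injective f ->
  (\sum_(g : {ffun 'I_K.+1 -> 'I_n} | injectiveb g)
     (image_edges H f == image_edges I g) = (H == I) * Defs.aut H)%N.
Proof.
move=> K0 Hr Ir f_inj.
have [[Hc _] _] := tree_reprs_tree Hr; have [[Ic _] _] := tree_reprs_tree Ir.
have [<-|HI] := eqVneq H I.
  rewrite mul1n -(card_copy_fiber H f_inj) -sum1dep_card [in RHS]big_mkcondr /=.
  apply: eq_bigr => g /injectiveP g_inj.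
  by rewrite copy_of_image_edges // eq_sym; case: ifP.
apply: big1 => g /injectiveP g_inj; apply/eqP; rewrite eqb0.
apply: contra HI; rewrite copy_of_image_edges // => /eqP/copy_of_iso iso.
by apply/eqP/tree_reprs_iso => //; exact: iso.
Qed.

(** The factorial ratio in [beta] is the inverse of the number of embeddings of [K + 1] vertices. *)
Lemma beta_ffact (R : realType) n K (q rho : R) : (K < n)%N ->
  beta n K q rho * (n ^_ K.+1)%:R = (rho / (q * (1 - q))) ^+ K.
Proof.
move=> Kn; rewrite /beta -mulrA.
have -> : (n - K - 1 = n - K.+1)%N by lia.
have := ffact_fact Kn; move/(congr1 (fun k => k%:R : R)); rewrite natrM => <-.
have f0 : (n - K.+1)`!%:R != 0 :> R by rewrite pnatr_eq0 -lt0n fact_gt0.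
have g0 : (n ^_ K.+1)%:R != 0 :> R by rewrite pnatr_eq0 -lt0n ffact_gt0.
by rewrite -[RHS]mulr1; congr (_ * _); field; rewrite f0 g0.
Qed.

Section Expansion.
Variables (R : realType) (n K : nat) (q rho : R).
Let emb := {ffun 'I_K.+1 -> 'I_n}.
Let index := (sgraph K.+1 * (emb * emb))%type.
Implicit Types i j : index.

(** An index is a tree with one embedding for A and one for B: a single monomial of the expanded
    statistic. *)
Definition admissible i : bool :=
  [&& i.1 \in tree_reprs K, injectiveb i.2.1 & injectiveb i.2.2].

Definition left_edges i := image_edges i.1 i.2.1.
Definition right_edges i := image_edges i.1 i.2.2.
Definition coef i : R := beta n K q rho / (Defs.aut i.1)%:R.

Lemma sum_admissible (F : index -> R) :
  \sum_(i | admissible i) F i = \sum_(H in tree_reprs K)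
    \sum_(f : emb | injectiveb f) \sum_(g : emb | injectiveb g) F (H, (f, g)).
Proof.
under [RHS]eq_bigr do rewrite pair_big_dep /=.
rewrite pair_big_dep /=; apply: eq_big => [i|[H [f g]] _] //=.
Qed.

Lemma f_stat_expand (AB : sgraph n * sgraph n) :
  f_stat K q rho AB = \sum_(i | admissible i)
    coef i * (centered_prod q (left_edges i) AB.1
              * centered_prod q (right_edges i) AB.2).
Proof.
rewrite f_statE sum_admissible; apply: eq_bigr => H _.
rewrite !embedding_sum_centered big_distrlr big_distrr /=.
by apply: eq_bigr => f _; rewrite big_distrr.
Qed.

Lemma admissible_sorted i : admissible i ->
  sorted_edges (left_edges i) /\ sorted_edges (right_edges i).
Proof.
by case/and3P => _ /injectiveP fi /injectiveP gi; split; exact: image_edges_sorted.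
Qed.

Lemma mean_f_stat_expand (r : R) :
  mean (coupled_pmf q r) (fun AB : sgraph n * sgraph n => f_stat K q rho AB) =
  \sum_(i | admissible i) coef i *
    joint_moment q r (left_edges i) finset.set0 (right_edges i) finset.set0.
Proof.
rewrite /mean; under eq_bigr do rewrite f_stat_expand big_distrr /=.
rewrite exchange_big /=; apply: eq_bigr => i /admissible_sorted[li ri].
have s0 : sorted_edges (finset.set0 : {set 'I_n * 'I_n}) by move=> e; rewrite inE.
rewrite -mean_centered_prod // /mean big_distrr /=; apply: eq_bigr => AB _.
rewrite mulrCA; congr (_ * (_ * _)).
by rewrite /centered_prod !big_set0 !mulr1.
Qed.

Lemma mean_f_stat_sq_expand (r : R) :
  mean (coupled_pmf q r) (fun AB : sgraph n * sgraph n => f_stat K q rho AB ^+ 2) =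
  \sum_(i | admissible i) \sum_(j | admissible j) coef i * coef j *
    joint_moment q r (left_edges i) (left_edges j) (right_edges i) (right_edges j).
Proof.
rewrite /mean; under eq_bigr do rewrite f_stat_expand expr2 big_distrlr big_distrr /=.
rewrite exchange_big /=; apply: eq_bigr => i /admissible_sorted[li ri].
under eq_bigr do rewrite big_distrr /=.
rewrite exchange_big /=; apply: eq_bigr => j /admissible_sorted[lj rj].
rewrite -mean_centered_prod // /mean big_distrr /=; apply: eq_bigr => AB _.
by ring.
Qed.

Hypothesis K_gt0 : (0 < K)%N.

(** Only the representative [i.1] survives, and each of the two matchings has [aut] solutions, which
    cancel the [aut] in both coefficients. The selectors [b1] and [b2] treat the straight and the
    crossed coincidence at once. *)
Lemma sum_coef_same (i : index) (b1 b2 : emb * emb -> emb) :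
  admissible i ->
  (forall (F G : emb -> R),
    \sum_(g1 : emb | injectiveb g1) \sum_(g2 : emb | injectiveb g2)
      F (b1 (g1, g2)) * G (b2 (g1, g2)) =
    (\sum_(g : emb | injectiveb g) F g) * (\sum_(g : emb | injectiveb g) G g)) ->
  \sum_(j | admissible j) coef i * coef j *
    ((left_edges i == image_edges j.1 (b1 j.2)) &&
     (right_edges i == image_edges j.1 (b2 j.2)))%:R = beta n K q rho ^+ 2.
Proof.
case/and3P => Hr /injectiveP fi /injectiveP gi bE.
rewrite sum_admissible /=.
have a0 : (Defs.aut i.1)%:R != 0 :> R by rewrite pnatr_eq0 -lt0n aut_gt0.
transitivity (\sum_(I in tree_reprs K) coef i * (beta n K q rho / (Defs.aut I)%:R) *
   (((i.1 == I) * Defs.aut i.1)%:R * ((i.1 == I) * Defs.aut i.1)%:R)).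
  apply: eq_bigr => I Ir.
  rewrite -{1}(card_same_image K_gt0 Hr Ir fi) -(card_same_image K_gt0 Hr Ir gi).
  rewrite !natr_sum -(bE (fun g => (image_edges i.1 i.2.1 == image_edges I g)%:R)
    (fun g => (image_edges i.1 i.2.2 == image_edges I g)%:R)) big_distrr /=.
  apply: eq_bigr => g1 _; rewrite big_distrr /=; apply: eq_bigr => g2 _.
  by rewrite -natrM mulnb.
rewrite (bigD1 i.1) //= big1 ?addr0.
  by rewrite eqxx mul1n /coef; field.
by move=> I /andP[_ Ii]; rewrite eq_sym (negbTE Ii) mul0n !mulr0.
Qed.

Lemma card_injections : #|[set f : emb | injectiveb f]| = (n ^_ K.+1)%N.
Proof. by rewrite card_inj_ffuns !card_ord. Qed.

Lemma sum_admissible_const (x : R) :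
  \sum_(i | admissible i) x = #|tree_reprs K|%:R * (n ^_ K.+1)%:R ^+ 2 * x.
Proof.
rewrite sum_admissible /= -card_injections.
under eq_bigr do under eq_bigr do rewrite sumr_const.
under eq_bigr do rewrite sumr_const.
have -> : #|[set f : emb | injectiveb f]| = #|[pred f : emb | injectiveb f]|.
  by apply: eq_card => f; rewrite !inE.
rewrite sumr_const -[LHS]mulr_natl -[X in _ * X]mulr_natl.
by rewrite -[X in _ * (_ * X)]mulr_natl; ring.
Qed.

Lemma sum_coef_same_straight :
  \sum_(i | admissible i) \sum_(j | admissible j) coef i * coef j *
    ((left_edges i == left_edges j) && (right_edges i == right_edges j))%:R
  = #|tree_reprs K|%:R * ((n ^_ K.+1)%:R * beta n K q rho) ^+ 2.
Proof.
rewrite exprMn mulrA -sum_admissible_const; apply: eq_bigr => i Pi.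
apply: (@sum_coef_same i fst snd Pi) => F G /=.
by rewrite big_distrlr.
Qed.

Lemma sum_coef_same_crossed :
  \sum_(i | admissible i) \sum_(j | admissible j) coef i * coef j *
    ((left_edges i == right_edges j) && (right_edges i == left_edges j))%:R
  = #|tree_reprs K|%:R * ((n ^_ K.+1)%:R * beta n K q rho) ^+ 2.
Proof.
rewrite exprMn mulrA -sum_admissible_const; apply: eq_bigr => i Pi.
apply: (@sum_coef_same i snd fst Pi) => F G /=.
rewrite mulrC big_distrlr /=; apply: eq_bigr => g1 _; apply: eq_bigr => g2 _.
by rewrite mulrC.
Qed.

End Expansion.

(** * Counting overlapping quadruples by their vertex set *)

Definition maps_into m n (W : {set 'I_n}) (f : {ffun 'I_m -> 'I_n}) : bool :=
  [forall x, f x \in W].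

Lemma sum_maps_into (R : realType) m n (W : {set 'I_n}) :
  \sum_(f : {ffun 'I_m -> 'I_n}) (maps_into W f)%:R = #|W|%:R ^+ m :> R.
Proof.
rewrite -natr_sum -natrX; congr (_%:R).
rewrite -[X in (_ ^ X)%N]card_ord -card_ffun_on -sum1_card [RHS]big_mkcond /=.
apply: eq_bigr => f _; congr (nat_of_bool _); apply/forallP/ffun_onP => //.
Qed.

Lemma ffact_le_expn n m : (n ^_ m <= n ^ m)%N.
Proof.
elim: m n => // m IHm n; rewrite ffactnS expnS leq_mul2l; apply/orP; right.
by apply: leq_trans (IHm _) _; case: m {IHm} => // m; rewrite leq_exp2r ?leq_pred.
Qed.

(** There are at most [n ^ k] sets of size [k]. *)
Lemma sum_sets_by_card (R : realType) n a b (h : nat -> R) :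
  (forall k, 0 <= h k) ->
  \sum_(W : {set 'I_n} | (a <= #|W| < b)%N) h #|W| <=
  \sum_(a <= k < b) n%:R ^+ k * h k.
Proof.
move=> h0.
apply: le_trans (_ : \sum_(a <= k < b)
    \sum_(W : {set 'I_n} | k == #|W|) h k <= _); last first.
  apply: ler_sum => k _; rewrite sumr_const -[leLHS]mulr_natl ler_wpM2r // -natrX ler_nat.
  apply: leq_trans (ffact_le_expn n k); rewrite -bin_ffact.
  have := card_draws 'I_n k; rewrite card_ord => <-.
  rewrite [leqLHS](_ : _ = #|[set A : {set 'I_n} | #|A| == k]|).
    by rewrite leq_pmulr ?fact_gt0.
  by apply: eq_card => W; rewrite !inE eq_sym.
under [leRHS]eq_bigr do rewrite big_mkcond /=.
rewrite exchange_big big_mkcond /=; apply: ler_sum => W _.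
by rewrite -big_mkcond /= big_nat1_eq.
Qed.

Section OverlapSum.
Variables (R : realType) (n K : nat) (q rho : R).
Let emb := {ffun 'I_K.+1 -> 'I_n}.
Let index := (sgraph K.+1 * (emb * emb))%type.
Implicit Types i j : index.

Definition vertices i j : {set 'I_n} :=
  [set i.2.1 x | x in 'I_K.+1] :|: [set j.2.1 x | x in 'I_K.+1]
    :|: ([set i.2.2 x | x in 'I_K.+1] :|: [set j.2.2 x | x in 'I_K.+1]).

Let into (W : {set 'I_n}) i : R :=
  (maps_into W i.2.1)%:R * (maps_into W i.2.2)%:R.

Lemma into_ge0 W i : 0 <= into W i. Proof. exact: mulr_ge0. Qed.

Lemma into_vertices i j : into (vertices i j) i * into (vertices i j) j = 1.
Proof.
have h (f : emb) : [set f x | x in 'I_K.+1] \subset vertices i j ->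
    maps_into (vertices i j) f.
  by move=> sub; apply/forallP => x; apply: (fintype.subsetP sub); apply: imset_f.
rewrite /into !h ?mulr1 //; apply/fintype.subsetP => x; rewrite !inE => -> //;
  by rewrite ?orbT.
Qed.

Lemma card_vertices_gt i j : admissible i -> (K < #|vertices i j|)%N.
Proof.
case/and3P => _ /injectiveP fi _.
rewrite -[K.+1]card_ord -(card_imset predT fi); apply/subset_leq_card.
by apply/fintype.subsetP => x; rewrite !inE => ->.
Qed.

Lemma sum_into W : \sum_(i | admissible i) into W i <=
  #|tree_reprs K|%:R * #|W|%:R ^+ (2 * K.+1).
Proof.
rewrite sum_admissible mulr_natl -sumr_const.
apply: ler_sum => H _; rewrite /into /=.
rewrite mul2n -addnn exprD -!sum_maps_into big_distrlr /=.
rewrite big_mkcond; apply: ler_sum => f _; case: ifP => _; last first.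
  by apply: sumr_ge0 => g _; rewrite mulr_ge0.
rewrite big_mkcond; apply: ler_sum => g _; case: ifP => _ //.
Qed.

Lemma coef_mul_le i j : coef q rho i * coef q rho j <= beta n K q rho ^+ 2.
Proof.
rewrite /coef mulrACA -expr2 ler_piMr ?sqr_ge0 // -invfM.
rewrite invf_le1 ?mulr_gt0 ?ltr0n ?aut_gt0 //.
by rewrite -natrM ler1n muln_gt0 !aut_gt0.
Qed.

Lemma coef_mul_ge0 i j : 0 <= coef q rho i * coef q rho j.
Proof. by rewrite /coef mulrACA -expr2 mulr_ge0 ?sqr_ge0 // mulr_ge0 ?invr_ge0. Qed.

(** Requiring that the union of the images be exactly [W] would tie the four embeddings together.
    Asking only that each maps into [W] overcounts, but the sum over [i] and [j] then becomes a
    square, and each embedding has at most [|W| ^ (K + 1)] choices with [|W| <= 2K + 1]. *)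
Lemma overlap_sum_le (s : R) : 0 <= s ->
  \sum_(i | admissible i) \sum_(j | admissible j) coef q rho i * coef q rho j *
     (if (#|vertices i j| <= 2 * K + 1)%N then s ^+ #|vertices i j|.-1 else 0) <=
  beta n K q rho ^+ 2 * (#|tree_reprs K|%:R ^+ 2 *
    ((2 * K + 1)%:R ^+ (4 * K.+1) *
     \sum_(K.+1 <= v < (2 * K).+2) n%:R ^+ v * s ^+ v.-1)).
Proof.
move=> s0.
(* The image of one injective embedding already has [K + 1] vertices, whence the lower end. *)
pose good (W : {set 'I_n}) := (K.+1 <= #|W| < (2 * K).+2)%N.
have step1 i j : admissible i ->
    (if (#|vertices i j| <= 2 * K + 1)%N then s ^+ #|vertices i j|.-1 else 0) <=
    \sum_(W | good W) s ^+ #|W|.-1 * (into W i * into W j).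
  move=> Pi; have t0 (W : {set _}) : 0 <= s ^+ #|W|.-1 * (into W i * into W j).
    by rewrite !mulr_ge0 ?exprn_ge0 ?into_ge0.
  case: ifP => [le_v|_]; last by apply: sumr_ge0 => W _.
  have gV : good (vertices i j) by rewrite /good card_vertices_gt //= ltnS -addn1.
  rewrite (bigD1 _ gV) /= into_vertices mulr1 lerDl.
  by apply: sumr_ge0.
apply: le_trans (_ : \sum_(i | admissible i) \sum_(j | admissible j)
   beta n K q rho ^+ 2 * \sum_(W | good W) s ^+ #|W|.-1 * (into W i * into W j) <= _).
  apply: ler_sum => i Pi; apply: ler_sum => j Pj.
  apply: ler_pM => //; [exact: coef_mul_ge0| |exact: coef_mul_le|exact: step1].
  by case: ifP => _; rewrite ?exprn_ge0.
under eq_bigr do rewrite -big_distrr /=.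
rewrite -big_distrr ler_wpM2l ?sqr_ge0 //=.
under eq_bigr do rewrite exchange_big /=.
rewrite exchange_big /=.
apply: le_trans (_ : \sum_(W | good W) #|tree_reprs K|%:R ^+ 2 *
   ((2 * K + 1)%:R ^+ (4 * K.+1) * s ^+ #|W|.-1) <= _).
  apply: ler_sum => W /andP[_ gW].
  have -> : \sum_(i | admissible i) \sum_(j | admissible j)
      s ^+ #|W|.-1 * (into W i * into W j) =
      s ^+ #|W|.-1 * (\sum_(i | admissible i) into W i) ^+ 2.
    rewrite expr2 big_distrlr big_distrr /=; apply: eq_bigr => i _.
    by rewrite big_distrr.
  rewrite [leRHS]mulrA [leRHS]mulrC ler_wpM2l ?exprn_ge0 //.
  have -> : #|tree_reprs K|%:R ^+ 2 * (2 * K + 1)%:R ^+ (4 * K.+1) =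
      (#|tree_reprs K|%:R * (2 * K + 1)%:R ^+ (2 * K.+1)) ^+ 2 :> R.
    by rewrite exprMn -exprM; congr (_ * _ ^+ _); lia.
  rewrite ler_sqr ?nnegrE; last 2 first.
  - by apply: sumr_ge0 => i _; exact: into_ge0.
  - by rewrite mulr_ge0 ?exprn_ge0.
  apply: le_trans (sum_into W) _; rewrite ler_wpM2l // -!natrX ler_nat.
  by rewrite leq_exp2r //; move: gW; lia.
rewrite -!big_distrr /= !ler_wpM2l ?exprn_ge0 //.
apply: (@sum_sets_by_card _ _ _ _ (fun k => s ^+ k.-1)) => k.
by rewrite exprn_ge0.
Qed.

End OverlapSum.

Section Moments.
Variables (R : realType) (n K : nat) (q rho : R).
Hypotheses (K_gt0 : (0 < K)%N) (Kn : (K < n)%N) (q01 : 0 < q < 1).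

Let emb := {ffun 'I_K.+1 -> 'I_n}.
Let index := (sgraph K.+1 * (emb * emb))%type.
Let stat (AB : sgraph n * sgraph n) : R := f_stat K q rho AB.
Let nbT : R := #|unlabeled_trees K|%:R.

Lemma variance_neq0 : q * (1 - q) != 0.
Proof. by case/andP: q01 => q0 q1; rewrite mulf_neq0 ?gt_eqF // subr_gt0. Qed.

Lemma card_admissible_edges (i : index) :
  admissible i -> #|left_edges i| = K /\ #|right_edges i| = K.
Proof.
case/and3P => /tree_reprs_tree[_ HK] /injectiveP fi /injectiveP gi.
by rewrite !card_image_edges.
Qed.

(** For each tree and each left embedding, exactly [aut H] right embeddings have the same edges;
    they cancel the [aut] in the coefficient. *)
Lemma mean_coupled_f_stat : mean (coupled_pmf q rho) stat = rho ^+ (2 * K) * nbT.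
Proof.
rewrite mean_f_stat_expand sum_admissible.
transitivity (\sum_(H in tree_reprs K) (rho * (q * (1 - q))) ^+ K *
  ((n ^_ K.+1)%:R * beta n K q rho)).
  apply: eq_bigr => H Hr; have [_ HK] := tree_reprs_tree Hr.
  have a0 : (Defs.aut H)%:R != 0 :> R by rewrite pnatr_eq0 -lt0n aut_gt0.
  transitivity (\sum_(f : {ffun 'I_K.+1 -> 'I_n} | injectiveb f)
      (rho * (q * (1 - q))) ^+ K * beta n K q rho).
    apply: eq_bigr => f /injectiveP fi.
    transitivity ((rho * (q * (1 - q))) ^+ K * (beta n K q rho / (Defs.aut H)%:R) *
        ((H == H) * Defs.aut H)%:R).
      rewrite -(card_same_image K_gt0 Hr Hr fi) natr_sum big_distrr /=.
      apply: eq_bigr => g /injectiveP gi.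
      rewrite joint_moment_pair; try exact: image_edges_sorted.
      by rewrite /left_edges card_image_edges // HK /coef; ring.
    by rewrite eqxx mul1n; field.
  rewrite sumr_const -card_injections cardsE -[LHS]mulr_natl.
  ring.
rewrite sumr_const card_tree_reprs -[LHS]mulr_natl mulrC; congr (_ * _).
have := variance_neq0; rewrite [_ * beta _ _ _ _]mulrC beta_ffact // => s0.
transitivity ((rho * (q * (1 - q)) * (rho / (q * (1 - q)))) ^+ K).
  by rewrite [RHS]exprMn.
rewrite exprM; congr (_ ^+ K).
by field; move: s0; rewrite mulf_eq0 negb_or andbC.
Qed.

Lemma ffact_beta_sq :
  ((n ^_ K.+1)%:R * beta n K q rho) ^+ 2 * (q * (1 - q)) ^+ (2 * K) = rho ^+ (2 * K).
Proof.
have := variance_neq0 => s0.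
rewrite [_ * beta _ _ _ _]mulrC beta_ffact // -exprM mulnC.
transitivity ((rho / (q * (1 - q)) * (q * (1 - q))) ^+ (2 * K)).
  by rewrite [RHS]exprMn.
by rewrite divfK.
Qed.

(** Only pairs of indices with the same edges on both sides survive. The value is the mean under the
    alternative, so Markov's inequality will give the inverse of that mean. *)
Lemma mean_null_f_stat_sq :
  mean (coupled_pmf q 0) (fun AB => stat AB ^+ 2) = rho ^+ (2 * K) * nbT.
Proof.
rewrite mean_f_stat_sq_expand -ffact_beta_sq /nbT -card_tree_reprs.
rewrite mulrC mulrA -sum_coef_same_straight // mulrC big_distrr /=.
apply: eq_bigr => i Pi; rewrite big_distrr /=; apply: eq_bigr => j Pj.
have [ci ci'] := card_admissible_edges Pi.
have [li ri] := admissible_sorted Pi; have [lj rj] := admissible_sorted Pj.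
rewrite joint_moment_indep // ci ci' addnn -mul2n.
by rewrite mulrCA.
Qed.

Lemma mean_coupled_cst (r c : R) :
  mean (coupled_pmf q r) (fun _ : sgraph n * sgraph n => c) = c.
Proof.
rewrite /mean -big_distrl /= -[RHS]mul1r; congr (_ * _).
rewrite (@sum_graph_pairs _ _ (fun _ a b => corr_bern q r a b)) big1 // => e _.
rewrite -(edge_moment00 q r); apply: eq_bigr => a _; apply: eq_bigr => b _.
by rewrite !expr0 !mulr1.
Qed.

(** The squared number of tree classes is left out, as it cancels against the squared mean. *)
Definition overlap_term : R := beta n K q rho ^+ 2 *
  ((2 * K + 1)%:R ^+ (4 * K.+1) *
   \sum_(K.+1 <= v < (2 * K).+2) n%:R ^+ v * (q * (1 - q)) ^+ v.-1).

(** Summing [covariance_bound] over all pairs of indices, the straight and the crossed coincidences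
    give [mu] each. *)
Lemma variance_f_stat : (forall a b, 0 <= corr_bern q rho a b) ->
  mean (coupled_pmf q rho) (fun AB => (stat AB - rho ^+ (2 * K) * nbT) ^+ 2) <=
  2 * (rho ^+ (2 * K) * nbT) + nbT ^+ 2 * overlap_term.
Proof.
move=> p0; set mu := _ * nbT.
have -> : mean (coupled_pmf q rho) (fun AB => (stat AB - mu) ^+ 2) =
    mean (coupled_pmf q rho) (fun AB => stat AB ^+ 2) - mu ^+ 2.
  transitivity (mean (coupled_pmf q rho) (fun AB => stat AB ^+ 2)
     - 2 * mu * mean (coupled_pmf q rho) stat
     + mean (coupled_pmf q rho) (fun _ : sgraph n * sgraph n => mu ^+ 2)).
    rewrite /mean big_distrr /= -sumrB -big_split /=.
    by apply: eq_bigr => AB _; ring.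
  by rewrite mean_coupled_f_stat mean_coupled_cst -/mu; ring.
have -> : mu ^+ 2 = \sum_(i : index | admissible i) \sum_(j : index | admissible j)
    coef q rho i * coef q rho j *
    (joint_moment q rho (left_edges i) finset.set0 (right_edges i) finset.set0 *
     joint_moment q rho (left_edges j) finset.set0 (right_edges j) finset.set0).
  rewrite /mu -mean_coupled_f_stat mean_f_stat_expand expr2 big_distrlr /=.
  by apply: eq_bigr => i _; apply: eq_bigr => j _; ring.
rewrite mean_f_stat_sq_expand -sumrB.
under eq_bigr do rewrite -sumrB.
have [s0 _] := bernoulli_variance_bounds q01.
have := overlap_sum_le n K q rho s0; rewrite card_tree_reprs -/nbT => le_overlap.
apply: le_trans (_ : _ <= (q * (1 - q)) ^+ (2 * K) *
    (#|tree_reprs K|%:R * ((n ^_ K.+1)%:R * beta n K q rho) ^+ 2 +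
     #|tree_reprs K|%:R * ((n ^_ K.+1)%:R * beta n K q rho) ^+ 2) +
  beta n K q rho ^+ 2 * (nbT ^+ 2 *
    ((2 * K + 1)%:R ^+ (4 * K.+1) *
     \sum_(K.+1 <= v < (2 * K).+2) n%:R ^+ v * (q * (1 - q)) ^+ v.-1))) _.
  apply: le_trans (lerD (lexx _) le_overlap).
  rewrite -{1}(sum_coef_same_straight _ _ _ K_gt0) -(sum_coef_same_crossed _ _ _ K_gt0).
  rewrite -big_split big_distrr -big_split /=; apply: ler_sum => i Pi.
  rewrite -big_split big_distrr -big_split /=; apply: ler_sum => j Pj.
  set c := coef q rho i * coef q rho j.
  have c0 : 0 <= c by exact: coef_mul_ge0.
  case/and3P: Pi => /tree_reprs_tree[[Hc _] HK] /injectiveP fi /injectiveP gi.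
  case/and3P: Pj => /tree_reprs_tree[[Ic _] IK] /injectiveP fj /injectiveP gj.
  have le1 := covariance_bound q01 p0 K_gt0 Hc Ic HK IK fi gi fj gj.
  rewrite -mulrBr; apply: le_trans (ler_wpM2l c0 le1) _.
  by rewrite [leLHS]mulrDr mulrCA [c * (_ + _)]mulrDr.
rewrite lerD //.
  by rewrite card_tree_reprs -/nbT -mulr2n -mulrnAr mulr2n /mu -ffact_beta_sq; lra.
by rewrite /overlap_term mulrCA.
Qed.

End Moments.

(** * From moments to the testing error *)

Lemma pr_le_mean (R : realType) (T : finType) (p X : T -> R) (E : pred T) (c : R) :
  0 < c -> (forall x, 0 <= p x) -> (forall x, 0 <= X x) ->
  (forall x, E x -> c <= X x) -> pr p E <= mean p X / c.
Proof.
move=> c0 p0 X0 EX; rewrite ler_pdivlMr // /pr /mean big_distrl /= big_mkcond.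
apply: ler_sum => x _; case: ifP => [/EX cX|_]; first by rewrite ler_wpM2l.
exact: mulr_ge0.
Qed.

Lemma null_pmfE (R : realType) n (q : R) (AB : sgraph n * sgraph n) :
  null_pmf q AB = coupled_pmf q 0 AB.
Proof.
rewrite /null_pmf /coupled_pmf -big_split; apply: eq_bigr => e _.
by rewrite /corr_bern mul0r mulr0 addr0.
Qed.

Lemma mean_alt_f_stat (R : realType) n K (q rho : R) :
  (0 < K)%N -> (K < n)%N -> 0 < q < 1 ->
  mean (alt_pmf q rho) (fun AB : sgraph n * sgraph n => f_stat K q rho AB) =
  rho ^+ (2 * K) * #|unlabeled_trees K|%:R.
Proof.
move=> K0 Kn q01; rewrite -(mean_coupled_f_stat rho K0 Kn q01).
by apply: mean_alt_pmf => s A B; rewrite f_stat_relabel.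
Qed.

(** Markov's inequality for [f ^+ 2] at level [C * mu] under the null law, and for [(f - mu) ^+ 2]
    at distance [(1 - C) * mu] under the alternative. *)
Lemma testing_error_le (R : realType) n K (q rho C : R) :
  (0 < K)%N -> (K < n)%N -> 0 < q < 1 ->
  - Num.min (q / (1 - q)) ((1 - q) / q) <= rho <= 1 -> rho != 0 -> 0 < C < 1 ->
  pr (null_pmf q) (fun AB : sgraph n * sgraph n =>
    C * (rho ^+ (2 * K) * #|unlabeled_trees K|%:R) <= f_stat K q rho AB)
  + pr (alt_pmf q rho) (fun AB : sgraph n * sgraph n =>
    f_stat K q rho AB <= C * (rho ^+ (2 * K) * #|unlabeled_trees K|%:R)) <=
  (C ^- 2 + 2 * (1 - C) ^- 2) / (rho ^+ (2 * K) * #|unlabeled_trees K|%:R)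
  + (1 - C) ^- 2 * (overlap_term n K q rho / rho ^+ (4 * K)).
Proof.
move=> K0 Kn q01 rho_bnd rho0 /andP[C0 C1].
set mu := rho ^+ (2 * K) * #|unlabeled_trees K|%:R.
pose f := @f_stat R n K q rho; rewrite -/f.
have p0 a b := corr_bern_ge0 a b q01 rho_bnd.
(* The value [rho = 0] is admissible, so the null law has nonnegative masses as well. *)
have nullb : - Num.min (q / (1 - q)) ((1 - q) / q) <= 0 <= (1 : R).
  case/andP: q01 => q0 q1; rewrite ler01 andbT oppr_le0 le_min.
  by rewrite !divr_ge0 // ?subr_ge0 ltW.
have rho2K : 0 < rho ^+ (2 * K) by rewrite exprM exprn_gt0 // exprn_even_gt0.
have T0 : 0 < #|unlabeled_trees K|%:R :> R by rewrite ltr0n unlabeled_trees_gt0.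
have mu0 : 0 < mu by rewrite mulr_gt0.
have C1' : 0 < 1 - C by rewrite subr_gt0.
have le1 : pr (null_pmf q) (fun AB => C * mu <= f AB) <= C ^- 2 * mu^-1.
  apply: le_trans (_ : _ <= mu / (C * mu) ^+ 2) _; last first.
    by rewrite le_eqVlt; apply/orP; left; apply/eqP; field; rewrite !gt_eqF.
  have sq : mean (@null_pmf R n q) (fun AB => f AB ^+ 2) = mu.
    rewrite /mu -(mean_null_f_stat_sq rho K0 Kn q01).
    by apply: eq_bigr => AB _; rewrite null_pmfE.
  rewrite -[X in _ <= X / _]sq.
  apply: pr_le_mean; first by rewrite exprn_gt0 // mulr_gt0.
  - move=> AB; rewrite null_pmfE; apply: prodr_ge0 => e _.
    exact: corr_bern_ge0.
  - by move=> AB; exact: sqr_ge0.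
  - move=> AB fAB; rewrite ler_sqr ?nnegrE //; first by rewrite mulr_ge0 ?ltW.
    by apply: le_trans fAB; rewrite mulr_ge0 ?ltW.
have le2 : pr (alt_pmf q rho) (fun AB => f AB <= C * mu) <=
    (2 * mu + #|unlabeled_trees K|%:R ^+ 2 * overlap_term n K q rho)
      / ((1 - C) * mu) ^+ 2.
  apply: le_trans (_ : mean (alt_pmf q rho) (fun AB => (f AB - mu) ^+ 2)
     / ((1 - C) * mu) ^+ 2 <= _); last first.
    rewrite ler_wpM2r ?invr_ge0 ?sqr_ge0 // mean_alt_pmf; last first.
      by move=> s A B; rewrite /f f_stat_relabel.
    exact: variance_f_stat.
  apply: pr_le_mean; first by rewrite exprn_gt0 // mulr_gt0.
  - move=> AB; apply: sumr_ge0 => s _; rewrite mulr_ge0 ?invr_ge0 //.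
    by apply: prodr_ge0 => e _.
  - by move=> AB; exact: sqr_ge0.
  - move=> AB fAB; rewrite -[leRHS]sqrrN opprB ler_sqr ?nnegrE.
    + by rewrite mulrBl mul1r lerB.
    + by rewrite mulr_ge0 ?ltW.
    + by rewrite subr_ge0; apply: le_trans fAB _; rewrite ger_pMl // ltW.
apply: le_trans (lerD le1 le2) _; rewrite le_eqVlt; apply/orP; left; apply/eqP.
have -> : rho ^+ (4 * K) = rho ^+ (2 * K) ^+ 2 by rewrite -exprM mulnAC.
rewrite /mu; move: (overlap_term n K q rho) (rho ^+ (2 * K)) rho2K => D r r0.
field.
by rewrite !gt_eqF.
Qed.

(** * Asymptotics *)

Lemma expn_le_ffact n m k : (k <= m.+1)%N -> ((n - m) ^ k <= n ^_ k)%N.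
Proof.
elim: k => // k IHk km; rewrite ffactnSr expnSr leq_mul //; first exact: IHk (ltnW km).
by rewrite leq_sub2l.
Qed.

(** [L] is the price of one missing edge, a bound for [1/(n q (1 - q))] that is at least 1. The
    factor [K + 1] counts the values of [v], and [4 ^+ K.+1] compares the power of [n] with the
    squared falling factorial. *)
Lemma overlap_ratio_le (R : realType) n K (q rho L : R) :
  (0 < K)%N -> (2 * K <= n)%N -> (K < n)%N -> 0 < q < 1 -> rho != 0 -> 1 <= L ->
  1 <= L * (n%:R * (q * (1 - q))) ->
  overlap_term n K q rho / rho ^+ (4 * K) <=
  (rho ^+ 2)^-1 ^+ K *
   (4 ^+ K.+1 * (2 * K + 1)%:R ^+ (4 * K.+1) * K.+1%:R * L ^+ K) / n%:R.
Proof.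
move=> K0 Kn2 Kn q01 rho0 L1 Ls.
have s0 : 0 < q * (1 - q) by case/andP: q01 => q0 q1; rewrite mulr_gt0 ?subr_gt0.
have n0 : 0 < n%:R :> R by rewrite ltr0n; lia.
have ff0 : 0 < (n ^_ K.+1)%:R :> R by rewrite ltr0n ffact_gt0.
set s := q * (1 - q) in s0 Ls *; set D : R := (2 * K + 1)%:R ^+ (4 * K.+1).
have D0 : 0 <= D by rewrite exprn_ge0.
have L0 : 0 < L by exact: lt_le_trans ltr01 L1.
have ns0 : 0 <= n%:R * s by exact: ltW (mulr_gt0 n0 s0).
have sum_le : \sum_(K.+1 <= v < (2 * K).+2) n%:R ^+ v * s ^+ v.-1 <=
    K.+1%:R * (n%:R * (n%:R * s) ^+ (2 * K) * L ^+ K).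
  have -> : K.+1%:R * (n%:R * (n%:R * s) ^+ (2 * K) * L ^+ K) =
      \sum_(K.+1 <= v < (2 * K).+2) (n%:R * (n%:R * s) ^+ (2 * K) * L ^+ K).
    rewrite sumr_const_nat -[RHS]mulr_natl; congr (_%:R * _); lia.
  rewrite big_seq_cond [leRHS]big_seq_cond; apply: ler_sum => v.
  rewrite mem_index_iota andbT => /andP[v1 v2].
  case: v v1 v2 => // v v1 v2 /=; rewrite exprS -!mulrA -exprMn ler_pM2l //.
  (* Here [v] is one less than the number of vertices, hence at least [K], and the deficit
     [2 * K - v] is at most [K]. *)
  have -> : (2 * K = v + (2 * K - v))%N by lia.
  rewrite exprD -mulrA ler_peMr ?exprn_ge0 //.
  apply: le_trans (_ : (n%:R * s) ^+ (2 * K - v) * L ^+ (2 * K - v) <= _).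
    by rewrite -exprMn exprn_ege1 // mulrC.
  rewrite ler_wpM2l ?exprn_ge0 //.
  by rewrite ler_weXn2l //; lia.
have ff_ge : n%:R ^+ (2 * K.+1) <= 4 ^+ K.+1 * (n ^_ K.+1)%:R ^+ 2 :> R.
  (* From [2 * K <= n] follows [n <= 2 (n - K)], and each factor of the falling factorial is at
     least [n - K]. *)
  have h : (n ^ K.+1 <= 2 ^ K.+1 * n ^_ K.+1)%N.
    apply: leq_trans (_ : 2 ^ K.+1 * (n - K) ^ K.+1 <= _)%N.
      by rewrite -expnMn leq_exp2r //; lia.
    by rewrite leq_mul2l expn_le_ffact // orbT.
  have -> : n%:R ^+ (2 * K.+1) = (n%:R ^+ K.+1) ^+ 2 :> R by rewrite mulnC exprM.
  have -> : 4 ^+ K.+1 = (2 ^+ K.+1) ^+ 2 :> R.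
    by rewrite exprAC; congr (_ ^+ _); ring.
  rewrite -exprMn.
  by rewrite ler_sqr ?nnegrE ?mulr_ge0 ?exprn_ge0 // -!natrX -natrM ler_nat.
have betaE : beta n K q rho = (rho / s) ^+ K / (n ^_ K.+1)%:R.
  by rewrite -(beta_ffact q rho Kn) mulfK ?gt_eqF.
rewrite /overlap_term -/D -/s betaE.
apply: le_trans (_ : ((rho / s) ^+ K / (n ^_ K.+1)%:R) ^+ 2 *
   (D * (K.+1%:R * (n%:R * (n%:R * s) ^+ (2 * K) * L ^+ K))) / rho ^+ (4 * K) <= _).
  apply: ler_wpM2r; first by rewrite invr_ge0 exprn_even_ge0 // oddM.
  by rewrite ler_wpM2l ?sqr_ge0 // ler_wpM2l.
have r0 : rho ^+ K != 0 by rewrite expf_neq0.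
have sK0 : s ^+ K != 0 by rewrite expf_neq0 // gt_eqF.
have -> : ((rho / s) ^+ K / (n ^_ K.+1)%:R) ^+ 2 *
   (D * (K.+1%:R * (n%:R * (n%:R * s) ^+ (2 * K) * L ^+ K))) / rho ^+ (4 * K) =
   ((rho ^+ 2)^-1 ^+ K * D * K.+1%:R * L ^+ K / n%:R) *
     (n%:R ^+ (2 * K.+1) / (n ^_ K.+1)%:R ^+ 2).
  have -> : rho ^+ (4 * K) = (rho ^+ K) ^+ 4 by rewrite mulnC exprM.
  have -> : (rho ^+ 2)^-1 ^+ K = ((rho ^+ K) ^+ 2)^-1 by rewrite exprVn exprAC.
  have -> : n%:R ^+ (2 * K.+1) = (n%:R ^+ K * n%:R) ^+ 2 :> R
    by rewrite mulnC exprM (exprSr _ K).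
  have -> : (n%:R * s) ^+ (2 * K) = (n%:R ^+ K * s ^+ K) ^+ 2
    by rewrite mulnC exprM exprMn.
  rewrite (expr_div_n rho).
  move: (rho ^+ K) (s ^+ K) (n%:R ^+ K) (L ^+ K) r0 sK0 => r t N l r0 t0.
  move: (n ^_ K.+1)%:R ff0 => ff ff0; field.
  by rewrite r0 t0 !gt_eqF.
apply: le_trans (_ : ((rho ^+ 2)^-1 ^+ K * D * K.+1%:R * L ^+ K / n%:R) * 4 ^+ K.+1 <= _).
  rewrite ler_wpM2l ?ler_pdivrMr ?exprn_gt0 //.
  by rewrite !mulr_ge0 ?exprn_ge0 ?invr_ge0 ?sqr_ge0 ?(ltW L0) ?(ltW n0).
rewrite le_eqVlt; apply/orP; left; apply/eqP; ring.
Qed.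

Lemma max1_exp_le (R : realType) (y l : R) K : 0 < y -> 0 <= l ->
  K%:R * (2 * ln y) <= l -> Num.max 1 y ^+ K <= expR (l / 2).
Proof.
move=> y0 l0 le_l; case: (leP 1 y) => [y1|_].
  by rewrite -(lnK y0) -expRM_natl ler_expR ler_pdivlMr //; lra.
by rewrite expr1n -expR0 ler_expR divr_ge0.
Qed.

(** With [l = ln n], every factor other than [L ^+ K] and [1/n] is absorbed into [l ^+ (6 * K)], and
    [16 K ln l <= l] says that [l ^+ K] is at most the sixteenth root of [n]. *)
Lemma overlap_ratio_small (R : realType) n K (q rho a l : R) :
  ln n%:R = l -> (0 < n)%N -> 0 < q < 1 -> rho != 0 -> (rho ^+ 2)^-1 <= a ->
  8 * a <= l -> 4 <= l -> expR 1 <= l -> (6 <= K)%N ->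
  K%:R * (16 * ln l) <= l ->
  K%:R * (2 * ln (1 / (n%:R * Num.min q (1 - q)))) <= l ->
  (2 * K < n)%N /\ overlap_term n K q rho / rho ^+ (4 * K) <= expR (- (l / 8)).
Proof.
move=> lnE n_gt0 q01 rho0 rho_a; set p := Num.min q (1 - q).
move=> l8a l4 le1 K6 K16 K2.
have l0 : 0 < l by exact: lt_le_trans l4.
have n0 : 0 < n%:R :> R by rewrite ltr0n.
have lnl1 : 1 <= ln l by rewrite -[leLHS]expRK ler_ln ?posrE ?expR_gt0.
have p0 : 0 < p by rewrite lt_min; case/andP: q01 => q0 q1; rewrite q0 subr_gt0.
have K0 : 0 <= K%:R :> R by [].
have Kl : 16 * K%:R <= l.
  by apply: le_trans K16; rewrite mulrC ler_wpM2l // ler_peMr.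
have K6R : 6 <= K%:R :> R by rewrite ler_nat.
have twoKl : (2 * K + 1)%:R <= l by rewrite natrD natrM; lra.
have Kn : (2 * K < n)%N.
  rewrite -(ltr_nat R); apply: lt_trans (ln_sublinear n0).
  by rewrite natrM lnE; lra.
split=> //.
(* The factor 2 in [L] compensates for [p / 2 <= q * (1 - q)], the larger of [q] and [1 - q] being
   at least one half. The maximum with 1 covers graphs with [n * p > 1]. *)
pose y : R := 1 / (n%:R * p); pose L := 2 * Num.max 1 y.
have y0 : 0 < y by rewrite divr_gt0 ?mulr_gt0.
have max1 : 1 <= Num.max 1 y by rewrite le_max lexx.
have maxy : y <= Num.max 1 y by rewrite le_max lexx orbT.
have L1 : 1 <= L by rewrite /L; lra.
have s_ge : p / 2 <= q * (1 - q).
  case/andP: q01 => q0 q1; rewrite /p; case: (leP q (1 - q)) => h; nra.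
have Ls : 1 <= L * (n%:R * (q * (1 - q))).
  apply: le_trans (_ : (2 * y) * (n%:R * (p / 2)) <= _).
    rewrite le_eqVlt; apply/orP; left; apply/eqP; rewrite /y; field.
    by rewrite !gt_eqF.
  have p2 : 0 <= p / 2 by rewrite divr_ge0 ?ltW.
  apply: ler_pM.
  - by rewrite mulr_ge0 ?ltW.
  - by rewrite mulr_ge0.
  - by rewrite /L ler_wpM2l.
  - by rewrite ler_wpM2l.
have := overlap_ratio_le (ltnW (ltnW (ltnW (ltnW (ltnW K6))))) (ltnW Kn)
  (leq_ltn_trans (leq_pmull K (isT : 0 < 2)%N) Kn) q01 rho0 L1 Ls.
move=> /le_trans; apply.
have maxK : Num.max 1 y ^+ K <= expR (l / 2) by rewrite max1_exp_le // ltW.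
have max0 : 0 <= Num.max 1 y by exact: le_trans max1.
have nE : n%:R = expR l by rewrite -lnE lnK.
have lK : l ^+ K <= expR (l / 16).
  rewrite -{1}(lnK l0) -expRM_natl ler_expR; lra.
have a0 : 0 < a.
  by apply: lt_le_trans rho_a; rewrite invr_gt0 exprn_even_gt0.
(* Both [2 * K + 1] and [K + 1] are replaced by [l]. *)
apply: le_trans (_ : a ^+ K * (4 ^+ K.+1 * l ^+ (4 * K.+1) * l *
    (2 ^+ K * expR (l / 2))) / expR l <= _).
  rewrite nE ler_wpM2r ?invr_ge0 ?expR_ge0 //; apply: ler_pM.
  - by rewrite exprn_ge0 // invr_ge0 sqr_ge0.
  - by rewrite !mulr_ge0 ?exprn_ge0 // mulr_ge0.
  - by rewrite lerXn2r ?nnegrE ?invr_ge0 ?sqr_ge0 // ltW.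
  apply: ler_pM.
  - by rewrite !mulr_ge0 ?exprn_ge0.
  - by rewrite exprn_ge0 // mulr_ge0.
  - apply: ler_pM; rewrite ?mulr_ge0 ?exprn_ge0 //.
      by rewrite ler_wpM2l ?exprn_ge0 // lerXn2r ?nnegrE // ltW.
    by rewrite -addn1 natrD; lra.
  - by rewrite /L exprMn ler_wpM2l ?exprn_ge0.
have step : a ^+ K * (4 ^+ K.+1 * l ^+ (4 * K.+1) * l * (2 ^+ K * expR (l / 2))) =
    (8 * a) ^+ K * 4 * l ^+ (4 * K + 5) * expR (l / 2).
  have -> : (8 * a) ^+ K = 4 ^+ K * 2 ^+ K * a ^+ K.
    by rewrite -(exprMn _ 4 2) -(exprMn _ (4 * 2)); congr (_ ^+ K); ring.
  have -> : (4 * K + 5 = (4 * K.+1).+1)%N by rewrite mulnS addnC.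
  by rewrite exprSr exprS; ring.
rewrite step.
apply: le_trans (_ : l ^+ (6 * K) * expR (l / 2) / expR l <= _).
  rewrite ler_wpM2r ?invr_ge0 ?expR_ge0 // ler_wpM2r ?expR_ge0 //.
  (* The total exponent [5 * K + 6] is at most [6 * K] because [6 <= K]. *)
  apply: le_trans (_ : l ^+ K * l * l ^+ (4 * K + 5) <= _).
    rewrite ler_wpM2r ?exprn_ge0 ?(ltW l0) //; apply: ler_pM => //.
      by rewrite exprn_ge0 // mulr_ge0 // ltW.
    by rewrite lerXn2r ?nnegrE ?mulr_ge0 ?(ltW a0) ?(ltW l0).
  rewrite -exprSr -exprD ler_weXn2l //; first lra.
  by move: K6; clear; lia.
rewrite mulnC exprM.
apply: le_trans (_ : expR (l / 16) ^+ 6 * expR (l / 2) / expR l <= _).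
  rewrite ler_wpM2r ?invr_ge0 ?expR_ge0 // ler_wpM2r ?expR_ge0 //.
  by rewrite lerXn2r ?nnegrE ?exprn_ge0 ?expR_ge0 // ltW.
(* The balance of exponents is 6/16 + 1/2 - 1 = -1/8. *)
rewrite -expRM_natl -expRN -!expRD ler_expR; lra.
Qed.

Lemma ln_nat_ge (R : realType) (M : R) : \forall n \near \oo%classic, M <= ln n%:R.
Proof.
near=> n; have nM : expR M <= n%:R by near: n; exact: nbhs_infty_ger.
rewrite -[leLHS]expRK ler_ln ?posrE ?expR_gt0 //.
exact: lt_le_trans (expR_gt0 M) nM.
Unshelve. all: by end_near. Qed.

(** Since a tree exists for every [K], all the roots are at least 1 and so is their limit
    [alpha^-1]. *)
Lemma otter_constant_gt0 (R : realType) (alpha : R) :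
  is_otter_constant alpha -> 0 < alpha.
Proof.
move=> halpha; rewrite -invr_gt0; apply: lt_le_trans ltr01 _.
rewrite -(cvg_lim _ halpha) //; apply: limr_ge; first exact: (cvgP _ halpha).
apply: nearW => k.
have T1 : 1 <= #|unlabeled_trees k|%:R :> R by rewrite ler1n unlabeled_trees_gt0.
by rewrite -[leLHS](powRr0 #|unlabeled_trees k|%:R) ler_powR.
Qed.

Lemma unlabeled_trees_growth (R : realType) (alpha gamma : R) :
  is_otter_constant alpha -> alpha < gamma ->
  \forall k \near \oo%classic, gamma^-1 ^+ k <= #|unlabeled_trees k|%:R.
Proof.
move=> halpha ag; have a0 := otter_constant_gt0 halpha.
have g0 : 0 < gamma := lt_trans a0 ag.
have ga : gamma^-1 < alpha^-1 by rewrite ltf_pV2 ?posrE.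
near=> k.
have k0 : (0 < k)%N by near: k; exact: nbhs_infty_gt.
have : gamma^-1 <= #|unlabeled_trees k|%:R `^ k%:R^-1.
  by near: k; exact: (cvgr_ge _ halpha _ ga).
move=> le_g; apply: le_trans (_ : (#|unlabeled_trees k|%:R `^ k%:R^-1) ^+ k <= _).
  by rewrite lerXn2r ?nnegrE ?invr_ge0 ?powR_ge0 // ltW.
by rewrite -powR_mulrn ?powR_ge0 // -powRrM mulVf ?powRr1 // pnatr_eq0 -lt0n.
Unshelve. all: by end_near. Qed.

(** The midpoint [gamma] of [alpha] and [alpha + delta] shares out the gap: eventually there are at
    least [gamma^-1 ^+ K] tree classes, while [rho ^+ (2 * K)] is at least [(alpha + delta) ^+ K].
    The inverse mean is then below a geometric sequence of ratio [z < 1]. *)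
Lemma mean_to_infinity (R : realType) (alpha delta : R) (rho : nat -> R)
    (K : nat -> nat) :
  is_otter_constant alpha -> 0 < delta ->
  (\forall n \near \oo%classic, alpha + delta <= rho n ^+ 2) ->
  (K n @[n --> \oo] --> \oo)%classic ->
  (((rho n ^+ (2 * K n) * #|unlabeled_trees (K n)|%:R)^-1
     @[n --> \oo]) --> (0 : R))%classic.
Proof.
move=> halpha d0 hrho hK; have a0 := otter_constant_gt0 halpha.
pose gamma := alpha + delta / 2; pose z := gamma / (alpha + delta).
have g0 : 0 < gamma by rewrite addr_gt0 ?divr_gt0.
have ad0 : 0 < alpha + delta by rewrite addr_gt0.
have z0 : 0 < z by rewrite divr_gt0.
have z1 : `|z| < 1 by rewrite gtr0_norm // ltr_pdivrMr // mul1r /gamma; lra.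
have ag : alpha < gamma by rewrite ltrDl divr_gt0.
have zK : (z ^+ (K n) @[n --> \oo] --> (0 : R))%classic.
  exact: (cvg_comp _ _ hK (cvg_expr z1)).
apply: (squeeze_cvgr _ (cvg_cst 0) zK).
have growth := unlabeled_trees_growth halpha ag.
near=> n.
have T_ge : gamma^-1 ^+ (K n) <= #|unlabeled_trees (K n)|%:R.
  by near: n; exact: hK _ growth.
have r_ge : alpha + delta <= rho n ^+ 2 by near: n.
have r0 : 0 <= rho n ^+ (2 * K n) by rewrite exprM exprn_ge0 ?sqr_ge0.
rewrite invr_ge0 mulr_ge0 //= -[leRHS]invrK lef_pV2 ?posrE; last 2 first.
- rewrite mulr_gt0 ?ltr0n ?unlabeled_trees_gt0 // exprM exprn_gt0 //.
  exact: lt_le_trans r_ge.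
- by rewrite invr_gt0 exprn_gt0.
rewrite -exprVn /z invfM invrK mulrC exprMn exprM.
apply: ler_pM => //; rewrite ?exprn_ge0 ?invr_ge0 ?(ltW ad0) ?(ltW g0) //.
by rewrite lerXn2r ?nnegrE ?sqr_ge0 ?(ltW ad0).
Unshelve. all: by end_near. Qed.

Lemma pr_ge0 (R : realType) (T : finType) (p : T -> R) (E : pred T) :
  (forall x, 0 <= p x) -> 0 <= pr p E.
Proof. by move=> p0; apply: sumr_ge0. Qed.

Local Open Scope classical_set_scope.

Theorem theorem1 (R : realType) (alpha : R) (halpha : is_otter_constant alpha)
    (q rho : nat -> R) (K : nat -> nat)
    (hq : forall n, 0 < q n < 1)
    (hrho : forall n,
      - Num.min (q n / (1 - q n)) ((1 - q n) / q n) <= rho n <= 1)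
    (hK0 : forall n, (0 < K n)%N)
    (hsparse : exists2 eps : nat -> R, eps n @[n --> \oo] --> (0 : R)
      & \forall n \near \oo,
          n%:R `^ (- eps n) <= n%:R * Num.min (q n) (1 - q n))
    (halpha_rho : exists2 delta : R, 0 < delta
      & \forall n \near \oo, alpha + delta <= rho n ^+ 2)
    (hK_infty : K n @[n --> \oo] --> \oo)
    (hK_upper : \forall n \near \oo,
      (K n)%:R <= ln n%:R /
        Num.max (16 * ln (ln n%:R))
                (2 * ln (1 / (n%:R * Num.min (q n) (1 - q n)))))
    (C : R) (hC : 0 < C < 1) :
  let f n := @f_stat R n (K n) (q n) (rho n) in
  let P n := @alt_pmf R n (q n) (rho n) in
  let Q n := @null_pmf R n (q n) in
  let tau n := C * mean (P n) (f n) in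
  (forall n, (K n < n)%N ->
     mean (P n) (f n) = rho n ^+ (2 * K n) * #|unlabeled_trees (K n)|%:R) /\
  (pr (Q n) (fun AB => tau n <= f n AB) + pr (P n) (fun AB => f n AB <= tau n))
    @[n --> \oo] --> (0 : R).
Proof.
move=> f P Q tau.
have meanE n : (K n < n)%N ->
    mean (P n) (f n) = rho n ^+ (2 * K n) * #|unlabeled_trees (K n)|%:R.
  by move=> Kn; apply: mean_alt_f_stat.
split=> //.
case: halpha_rho => delta d0 rho_ge.
have mu_cvg := mean_to_infinity halpha d0 rho_ge hK_infty.
have a0 := otter_constant_gt0 halpha.
have exp_cvg : expR (- (ln (n%:R : R) / 8)) @[n --> \oo] --> (0 : R).
  have ln8 : ln (n%:R : R) / 8 @[n --> \oo] --> +oo.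
    apply/cvgryPge => A; near=> n.
    by rewrite ler_pdivlMr //; near: n; exact: ln_nat_ge.
  exact: (cvg_comp _ _ ln8 (@cvgr_expR R)).
pose c1 := C ^- 2 + 2 * (1 - C) ^- 2; pose c2 := (1 - C) ^- 2.
have bound_cvg : c1 * (rho n ^+ (2 * K n) * #|unlabeled_trees (K n)|%:R)^-1
    + c2 * expR (- (ln (n%:R : R) / 8)) @[n --> \oo] --> (0 : R).
  rewrite -[X in _ --> X](_ : c1 * 0 + c2 * 0 = 0 :> R); last by rewrite !mulr0 addr0.
  by apply: cvgD; apply: cvgMr.
apply: (squeeze_cvgr _ (cvg_cst 0) bound_cvg).
near=> n.
have n0 : (0 < n)%N by near: n; exact: nbhs_infty_gt.
have r_ge : alpha + delta <= rho n ^+ 2 by near: n.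
have r2 : 0 < rho n ^+ 2 by apply: lt_le_trans r_ge; rewrite addr_gt0.
have rho0 : rho n != 0 by apply: contraTneq r2 => ->; rewrite expr0n ltxx.
have l8a : 8 * alpha^-1 <= ln (n%:R : R) by near: n; exact: ln_nat_ge.
have l4 : 4 <= ln (n%:R : R) by near: n; exact: ln_nat_ge.
have le1 : expR 1 <= ln (n%:R : R) by near: n; exact: ln_nat_ge.
have K6 : (6 <= K n)%N by near: n; move/cvgnyPge: hK_infty; exact.
have Kup : (K n)%:R <= ln n%:R / Num.max (16 * ln (ln n%:R))
    (2 * ln (1 / (n%:R * Num.min (q n) (1 - q n)))) :> R by near: n.
(* This makes the maximum [m] positive, so that the bound on [K n] can be multiplied out and applied
   to each entry of the maximum. *)
have lnl1 : 1 <= ln (ln (n%:R : R)).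
  rewrite -[leLHS]expRK ler_ln ?posrE ?expR_gt0 //; exact: lt_le_trans l4.
move: Kup; set m := Num.max _ _ => Kup.
have m1 : 16 * ln (ln n%:R) <= m by rewrite le_max lexx.
have m2 : 2 * ln (1 / (n%:R * Num.min (q n) (1 - q n))) <= m by rewrite le_max lexx orbT.
have m0 : 0 < m by lra.
have {}Kup : (K n)%:R * m <= ln n%:R by rewrite -ler_pdivlMr.
have K16 : (K n)%:R * (16 * ln (ln n%:R)) <= ln n%:R :> R.
  by apply: le_trans Kup; rewrite ler_wpM2l.
have K2 : (K n)%:R * (2 * ln (1 / (n%:R * Num.min (q n) (1 - q n)))) <= ln n%:R.
  by apply: le_trans Kup; rewrite ler_wpM2l.
have rho_a : (rho n ^+ 2)^-1 <= alpha^-1.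
  by rewrite lef_pV2 ?posrE //; apply: le_trans r_ge; rewrite lerDl ltW.
have [Kn2 small] := overlap_ratio_small erefl n0 (hq n) rho0 rho_a l8a l4 le1 K6 K16 K2.
have Kn : (K n < n)%N by apply: leq_ltn_trans Kn2; rewrite leq_pmull.
(* The lower side of the squeeze needs only nonnegative masses for both laws. *)
apply/andP; split.
  apply: addr_ge0; apply: pr_ge0 => AB.
    rewrite /Q null_pmfE; apply: prodr_ge0 => e _; apply: corr_bern_ge0 => //.
    have /andP[q0 q1] := hq n.
    by rewrite ler01 andbT oppr_le0 le_min !divr_ge0 // ?subr_ge0 ltW.
  apply: sumr_ge0 => s _; rewrite mulr_ge0 ?invr_ge0 //.
  by apply: prodr_ge0 => e _; apply: corr_bern_ge0.
rewrite /tau (meanE n Kn).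
apply: le_trans (testing_error_le (hK0 n) Kn (hq n) (hrho n) rho0 hC) _.
by rewrite lerD2l ler_wpM2l // invr_ge0 sqr_ge0.
Unshelve. all: by end_near. Qed.
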